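(* Let $r\ge 2$ be an integer, $C>0$, $p\in[1,\infty)$ and $q\in[1,\infty]$. Let $\{A_i\}_{i=1}^\infty$, $A_i\in\mathcal{B}_r(\Omega_i)$, be a Cauchy sequence (with respect to $d_M$) of $r$-th order multi-$P$-operators, acting on possibly different probability spaces $\Omega_i$, such that $\|A_i\|_{p,\ldots,p\to q}\le C$ for all $i\in\mathbb{N}$. Then there is an $r$-th order multi-$P$-operator $A$ (acting on some probability space) such that $\lim_{i\to\infty} d_M(A_i,A)=0$ and $$\|A\|_{p,\ldots,p\to q}\le \sup_{i\in\mathbb{N}}\|A_i\|_{p,\ldots,p\to q}\le C.$$ In particular, the sequence $\{A_i\}_{i=1}^\infty$ is action convergent.
   Context: An $r$-th order multi-$P$-operator acting on a probability space $(\Omega,\mathcal{F},\mathbb{P})$ is a multi-linear operator $A:L^\infty(\Omega)^{r-1}\to L^1(\Omega)$ (real-valued functions) such that $$\|A\|_{\infty\to 1}:=\sup_{0\neq f^{(i)}\in L^\infty(\Omega)}\frac{\|A[f^{(1)},\ldots,f^{(r-1)}]\|_1}{\|f^{(1)}\|_\infty\cdots\|f^{(r-1)}\|_\infty}<\infty .$$ $\mathcal{B}_r(\Omega)$ is the set of all $r$-th order multi-$P$-operators acting on $\Omega$. For $p,q\in[1,\infty]$, $$\|A\|_{p,\ldots,p\to q}:=\sup_{0\neq f^{(i)}\in L^\infty(\Omega)}\frac{\|A[f^{(1)},\ldots,f^{(r-1)}]\|_q}{\|f^{(1)}\|_p\cdots\|f^{(r-1)}\|_p}.$$ $L^\infty_{[-1,1]}(\Omega)$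 denotes the functions in $L^\infty(\Omega)$ with values in $[-1,1]$ almost everywhere, and $\mathcal{L}(\cdot)$ denotes the law of a random vector. For an integer $k\ge1$ the $k$-profile $\mathcal{S}_k(A)\subset\mathcal{P}(\mathbb{R}^{rk})$ is the set of all laws $$\mathcal{L}\big(f_1^{(1)},\ldots,f_1^{(r-1)},A[f_1^{(1)},\ldots,f_1^{(r-1)}],\ldots,f_k^{(1)},\ldots,f_k^{(r-1)},A[f_k^{(1)},\ldots,f_k^{(r-1)}]\big)$$ with all $f^{(j)}_i\in L^\infty_{[-1,1]}(\Omega)$. $d_{\mathcal{LP}}$ is the Lévy–Prokhorov metric on Borel probability measures on Euclidean space: $d_{\mathcal{LP}}(\eta_1,\eta_2)=\inf\{\varepsilon>0:\eta_1(U)\le\eta_2(U^\varepsilon)+\varepsilon,\ \eta_2(U)\le\eta_1(U^\varepsilon)+\varepsilon \text{ for all Borel } U\}$, $U^\varepsilon$ being the set of points at Euclidean distance less than $\varepsilon$ from $U$. $d_H$ is the associated Hausdorff distance between sets of probability measures: $d_H(X,Y)=\max\{\sup_{x\in X}\inf_{y\in Y}d_{\mathcal{LP}}(x,y),\sup_{y\in Y}\inf_{x\in X}d_{\mathcal{LP}}(x,y)\}$. The action convergence (pseudo-)metric between $r$-th order multi-$P$-operators (possibly acting on different probability spaces) is $d_M(A,B)=\sum_{k\ge1}2^{-k}d_H(\mathcal{S}_k(A),\mathcal{S}_k(B))$. A sequence is Cauchy if it is Cauchy in $d_M$. It is action convergent to $A$ if it is Cauchy and $d_H(\mathcal{S}_k(A_i),\mathcal{S}_k(A))\to0$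 for every $k$; it is action convergent if such a multi-$P$-operator $A$ exists. *)

(* Defs.v *)
(* MathComp-Analysis *)
From HB Require Import structures.
From mathcomp Require Import all_boot all_order all_algebra.
From mathcomp Require Import all_classical all_reals all_analysis.
Set Implicit Arguments.
Unset Strict Implicit.
Unset Printing Implicit Defensive.
Import Order.TTheory GRing.Theory Num.Theory.
Import numFieldNormedType.Exports.

Local Open Scope classical_set_scope.
Local Open Scope ring_scope.

(* Elements of L^oo and L^1 are represented by functions; equality of classes
   is equality almost everywhere. *)
Notation Linfty P := (LfunType P (leey 1%E)).
Notation Lone P := (LfunType P (lexx 1%E)).

Definition upd (n : nat) (X : Type) (f : 'I_n -> X) (i : 'I_n) (g : X) :
  'I_n -> X := fun j => if j == i then g else f j.

Section operator_norm.
Context (R : realType) (d : measure_display) (T : measurableType d).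
Context (P : probability T R).

(* The denominators are finite and positive when 1 <= p, since P is a
   probability and no f i vanishes almost everywhere. *)
Definition opnorm (n : nat) (p q : \bar R)
    (A : ('I_n -> Linfty P) -> Lone P) : \bar R :=
  ereal_sup [set ('N[P]_q[EFin \o A f] /
                  \big[mule/1]_(i < n) 'N[P]_p[EFin \o f i])%E
            | f in [set f : 'I_n -> Linfty P |
                     forall i, ~ (f i = cst 0 %[ae P])]].

(* An r-th order operator has r.-1 arguments.  The field multiPop_ae makes the
   map on representatives a map L^oo x ... x L^oo -> L^1 on classes. *)
Record multiPop (r : nat) := MultiPop {
  multiPop_fun :> ('I_r.-1 -> Linfty P) -> Lone P ;
  multiPop_ae : forall f g : 'I_r.-1 -> Linfty P,
    (forall i, f i = g i %[ae P]) -> multiPop_fun f = multiPop_fun g %[ae P] ;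
  multiPop_linear : forall (f : 'I_r.-1 -> Linfty P) (i : 'I_r.-1) (a : R)
      (g h : Linfty P),
    multiPop_fun (upd f i (a *: g + h)) =
    a *: multiPop_fun (upd f i g) + multiPop_fun (upd f i h) %[ae P] ;
  multiPop_bounded : (opnorm +oo 1 multiPop_fun < +oo)%E
}.

End operator_norm.

Section profile.
Context (R : realType) (d : measure_display) (T : measurableType d).
Context (P : probability T R) (r : nat) (A : multiPop P r).

(* Row i is (f_i^(1), ..., f_i^(r-1), A[f_i^(1), ..., f_i^(r-1)]) at x. *)
Definition profile_mx (k : nat) (f : 'I_k -> 'I_r.-1 -> Linfty P) (x : T) :
    'M[R]_(k, r) :=
  \matrix_(i, j) if insub (val j) is Some l then f i l x else A (f i) x.

Definition profile_vec (k : nat) (f : 'I_k -> 'I_r.-1 -> Linfty P) (x : T) :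
    (k * r).-tuple R :=
  [tuple mxvec (profile_mx f x) ord0 s | s < k * r].

Lemma measurable_profile_vec (k : nat) (f : 'I_k -> 'I_r.-1 -> Linfty P) :
  measurable_fun [set: T] (profile_vec f).
Proof.
apply/measurable_fun_tnthP => s.
case/mxvec_indexP: s => i j.
have -> : (@tnth _ R ^~ (mxvec_index i j)) \o profile_vec f =
    (if insub (val j) is Some l then f i l : T -> R else A (f i)).
  apply/funext => x /=; rewrite tnth_mktuple mxvecE mxE.
  by case: insub.
by case: insub => [l|]; exact: measurable_funPT.
Qed.

HB.instance Definition _ (k : nat) (f : 'I_k -> 'I_r.-1 -> Linfty P) :=
  @isMeasurableFun.Build _ _ T ((k * r).-tuple R) (profile_vec f)
    (measurable_profile_vec f).

Definition profile (k : nat) : set (probability ((k * r).-tuple R) R) :=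
  [set distribution P (profile_vec f)
  | f in [set f : 'I_k -> 'I_r.-1 -> Linfty P |
           forall i j, {ae P, forall x, -1 <= f i j x <= 1}]].

End profile.

Arguments profile {R d T P r} A k.

Section levy_prokhorov.
Context (R : realType) (n : nat).

Definition edist (x y : n.-tuple R) : R :=
  Num.sqrt (\sum_(i < n) (tnth x i - tnth y i) ^+ 2).

Definition thicken (U : set (n.-tuple R)) (e : R) : set (n.-tuple R) :=
  [set x | exists2 y, U y & edist x y < e].

(* The sigma-algebra of n.-tuple R is the product of the Borel sigma-algebras
   of R, that is, the Borel sigma-algebra of the Euclidean space. *)
Definition dLP (mu nu : probability (n.-tuple R) R) : R :=
  inf [set e : R | 0 < e /\
    forall U : set (n.-tuple R), measurable U ->
      (mu U <= nu (thicken U e) + e%:E)%E /\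
      (nu U <= mu (thicken U e) + e%:E)%E].

Definition dH (X Y : set (probability (n.-tuple R) R)) : \bar R :=
  Order.max
    (ereal_sup [set ereal_inf [set (dLP x y)%:E | y in Y] | x in X])
    (ereal_sup [set ereal_inf [set (dLP x y)%:E | x in X] | y in Y]).

End levy_prokhorov.

Definition dM (R : realType) (r : nat)
    (d1 : measure_display) (T1 : measurableType d1) (P1 : probability T1 R)
    (d2 : measure_display) (T2 : measurableType d2) (P2 : probability T2 R)
    (A : multiPop P1 r) (B : multiPop P2 r) : \bar R :=
  (\sum_(1 <= k <oo) (2%:R ^- k)%:E * dH (profile A k) (profile B k))%E.

Section action_convergence.
Context (R : realType) (r : nat).
Context (d : nat -> measure_display) (T : forall i, measurableType (d i)).
Context (P : forall i, probability (T i) R) (A : forall i, multiPop (P i) r).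

Definition dM_cauchy : Prop :=
  forall e : R, 0 < e -> exists N : nat,
    forall i j : nat, (N <= i)%N -> (N <= j)%N -> (dM (A i) (A j) < e%:E)%E.

Definition action_convergent_to (d0 : measure_display)
    (T0 : measurableType d0) (P0 : probability T0 R) (A0 : multiPop P0 r) :=
  dM_cauchy /\
  forall k : nat, (1 <= k)%N ->
    dH (profile (A i) k) (profile A0 k) @[i --> \oo] --> 0%E.

Definition action_convergent : Prop :=
  exists (d0 : measure_display) (T0 : measurableType d0)
    (P0 : probability T0 R) (A0 : multiPop P0 r), action_convergent_to A0.

End action_convergence.

(* Main.v *)
(* The limit is an ultraproduct. Fix a nonprincipal ultrafilter omega on nat and
   equip the product of the Omega_i with its Loeb measure: a set is measurable when
   it agrees, up to a null set, with an internal set {x | F_i (x_i) for omega-many i},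
   whose measure is the limit of P_i (F_i) along omega. Bounded measurable functions
   f on the Loeb space lift to uniformly bounded f_i with f_i (x_i) -> f x for almost
   every x, and A[f] is the limit of A_i[f_i]. It exists because ||A_i[f_i]||_1 is
   bounded, and it does not depend on the lift because p < oo makes the difference of
   two lifts infinitesimal in L^p. Fatou's lemma bounds the norm of A.
   Convergence almost everywhere along omega implies convergence of the laws, so by
   the lifting property the k-profile of A consists exactly of the limits along omega
   of elements of the k-profiles of the A_i. The Cauchy property then turns limits
   along omega into limits in the Hausdorff distance. *)
Require Import Defs.
From HB Require Import structures.
From mathcomp Require Import all_boot all_order all_algebra.
From mathcomp Require Import all_classical all_reals all_analysis.
From mathcomp Require Import measurable_realfun ess_sup_inf.
From mathcomp Require Import ring lra.
Set Implicit Arguments.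
Unset Strict Implicit.
Unset Printing Implicit Defensive.
Import Order.TTheory GRing.Theory Num.Theory.
Import numFieldNormedType.Exports.
Local Open Scope classical_set_scope.
Local Open Scope ring_scope.

(** * Limits along a nonprincipal ultrafilter *)

(** A limit of laws alone would provide values only for the arguments it was built from, whereas an
    operator needs all of L^oo of one space as its domain; on the ultraproduct every bounded
    measurable function has a lift, so nothing remains to be extended. The sigma-algebra needs no
    Caratheodory extension either: saturation shows directly that the sets agreeing with an internal
    set up to a null set are stable under countable unions. An asymmetry between arguments and
    values shapes the estimates. Arguments have uniformly bounded lifts, so their L^p norms converge
    for finite p; this is why a bound M accompanies every lift. The norms of the values may drop in
    the limit, so only lower semicontinuity is available for them, which is the direction that the
    norm inequality needs. For p = oo two lifts of one function may differ by functions of sup norm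
    1 on sets of infinitesimal measure, and the operators may send such differences to something
    that does not vanish. *)

Lemma nonprincipal_ultrafilter :
  {F : set_system nat | UltraFilter F /\ \oo `<=` F}.
Proof. exact/cid/ultraFilterLemma. Qed.

Definition omega : set_system nat := projT1 nonprincipal_ultrafilter.

#[global] Instance omega_ultra : UltraFilter omega.
Proof. exact: (projT2 nonprincipal_ultrafilter).1. Qed.

#[global] Instance nbhs_omega_ultra : UltraFilter (nbhs omega) := omega_ultra.

Lemma omega_ge (n : nat) : \forall i \near omega, (n <= i)%N.
Proof. by apply: (projT2 nonprincipal_ultrafilter).2; exact: nbhs_infty_ge. Qed.

Lemma omega_ex2 (Q Q' : nat -> Prop) :
  (\forall i \near omega, Q i) -> (\forall i \near omega, Q' i) ->
  exists i, Q i /\ Q' i.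
Proof. by move=> oQ oQ'; exact: filter_ex (filterI oQ oQ'). Qed.

Lemma omega_notP (Q : nat -> Prop) :
  ~ (\forall i \near omega, Q i) <-> \forall i \near omega, ~ Q i.
Proof.
split=> [nQ|nQ yQ]; first by case: (in_ultra_setVsetC [set i | Q i] omega_ultra).
by have [i []] := omega_ex2 nQ yQ.
Qed.

Lemma omega_or (Q Q' : nat -> Prop) :
  (\forall i \near omega, Q i \/ Q' i) ->
  (\forall i \near omega, Q i) \/ (\forall i \near omega, Q' i).
Proof.
move=> QQ'; have [|/omega_notP nQ] := pselect (\forall i \near omega, Q i);
  first by left.
by right; apply: filterS2 nQ QQ' => i nQi [].
Qed.

(** At index i take the largest m <= i with [Q m i], and 0 if there is none. The restriction to m <=
    i makes the maximum exist, and [omega_ge] makes it harmless. This diagonal choice is the source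
    of countable saturation. *)
Lemma omega_diag (Q : nat -> nat -> Prop) :
  (forall m, \forall i \near omega, Q m i) ->
  exists m : nat -> nat, (\forall i \near omega, Q (m i) i) /\
    forall n, \forall i \near omega, (n <= m i)%N.
Proof.
move=> Qo.
have /choice[m mP] i : exists m, (Q 0 i -> Q m i) /\
    forall n, (n <= i)%N -> Q n i -> (n <= m)%N.
  have [[n0 [n0i Q0]]|nQ] := pselect (exists n, (n <= i)%N /\ Q n i); last first.
    by exists 0%N; split=> [//|n ni Qn]; exfalso; apply: nQ; exists n.
  pose q n := (n <= i)%N && `[< Q n i >].
  have ex : exists n, q n.
    by exists n0; rewrite /q n0i; exact/asboolP.
  have ub n : q n -> (n <= i)%N.
    by move=> /andP[].
  case: (ex_maxnP ex ub) => m /= /andP[mi /asboolP Qm] mmax.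
  exists m; split=> // n ni Qn; apply: mmax; rewrite /q ni; exact/asboolP.
exists m; split; first by apply: filterS (Qo 0%N) => i; exact: (mP i).1.
by move=> n; apply: filterS2 (Qo n) (omega_ge n) => i Qn ni; exact: (mP i).2.
Qed.

Definition ulim (R : realType) (a : nat -> R) : R := lim (a @ omega).

(** The image of an ultrafilter under [a] is again an ultrafilter; it contains the compact segment
    [-M, M] and therefore converges. *)
Lemma cvg_ulim (R : realType) (a : nat -> R) (M : R) :
  (\forall i \near omega, `|a i| <= M) -> a @ omega --> ulim a.
Proof.
move=> aM.
have := @segment_compact R (- M) M; rewrite compact_ultra => cpt.
have Ua : UltraFilter (a @ omega).
  split; first exact: fmap_proper_filter.
  move=> G PG sG; apply/seteqP; split=> // A GA; rewrite /fmap/=.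
  have [//|nA] := in_ultra_setVsetC (a @^-1` A) omega_ultra.
  have GnA : G (~` A) by apply: sG.
  by have [x []] := filter_ex (filterI GA GnA).
have [|l [_ al]] := cpt _ Ua.
  by apply: filterS aM => i /=; rewrite in_itv/= ler_norml.
by rewrite /ulim; apply: cvgP; exact: al.
Qed.

Lemma cvg_omega_norm (R : realType) (a : nat -> R) (l : R) :
  a @ omega --> l <-> forall e, 0 < e -> \forall i \near omega, `|a i - l| <= e.
Proof.
split=> [al e e0|al].
  move/cvgrPdist_le : al => /(_ e e0); apply: filterS => i.
  by rewrite distrC.
apply/cvgrPdist_le => e e0; apply: filterS (al e e0) => i.
by rewrite distrC.
Qed.

Lemma cvg_omega_uniq (R : realType) (a : nat -> R) (l l' : R) :
  a @ omega --> l -> a @ omega --> l' -> l = l'.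
Proof. exact: cvg_unique. Qed.

(** The slack e admits bounds that are themselves known only in the limit. *)
Lemma cvg_omega_le (R : realType) (a : nat -> R) (l c : R) :
  a @ omega --> l -> (forall e, 0 < e -> \forall i \near omega, a i <= c + e) ->
  l <= c.
Proof.
move=> /cvg_omega_norm al ac; apply/ler_addgt0Pr => e e0.
have e20 : 0 < e / 2 by lra.
have [i []] := omega_ex2 (al _ e20) (ac _ e20).
by rewrite ler_norml => /andP[? ?] ?; lra.
Qed.

Lemma cvg_omega_ge (R : realType) (a : nat -> R) (l c : R) :
  a @ omega --> l -> (forall e, 0 < e -> \forall i \near omega, c - e <= a i) ->
  c <= l.
Proof.
move=> /cvg_omega_norm al ac; apply/ler_addgt0Pr => e e0.
have e20 : 0 < e / 2 by lra.
have [i []] := omega_ex2 (al _ e20) (ac _ e20).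
by rewrite ler_norml => /andP[? ?] ?; lra.
Qed.

Lemma cvg_omega_ub (R : realType) (a : nat -> R) (l c : R) :
  a @ omega --> l -> l < c -> \forall i \near omega, a i < c.
Proof.
move=> /cvg_omega_norm al lc.
have e0 : 0 < (c - l) / 2 by lra.
by apply: filterS (al _ e0) => i; rewrite ler_norml => /andP[? ?]; lra.
Qed.

Lemma cvg_omega_lb (R : realType) (a : nat -> R) (l c : R) :
  a @ omega --> l -> c < l -> \forall i \near omega, c < a i.
Proof.
move=> /cvg_omega_norm al lc.
have e0 : 0 < (l - c) / 2 by lra.
by apply: filterS (al _ e0) => i; rewrite ler_norml => /andP[? ?]; lra.
Qed.

(** * The Loeb measure *)

Section probability_real.
Context (R : realType) (d : measure_display) (T : measurableType d).
Context (P : probability T R).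

(** Real-valued, so that limits along [omega] are taken in R and estimates reduce to linear
    arithmetic. *)
Definition pr (E : set T) : R := fine (P E).

Lemma prE E : measurable E -> P E = (pr E)%:E.
Proof. by move=> mE; rewrite /pr fineK// fin_num_measure. Qed.

Lemma pr_ge0 E : 0 <= pr E.
Proof. by rewrite /pr fine_ge0. Qed.

Lemma pr_le1 E : measurable E -> pr E <= 1.
Proof. by move=> mE; rewrite -lee_fin -prE// probability_le1. Qed.

Lemma pr_set0 : pr set0 = 0.
Proof. by rewrite /pr measure0. Qed.

Lemma pr_setT : pr setT = 1.
Proof. by rewrite /pr probability_setT. Qed.

Lemma pr_le A B : measurable A -> measurable B -> A `<=` B -> pr A <= pr B.
Proof.
by move=> mA mB AB; rewrite -lee_fin -!prE// le_measure// inE.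
Qed.

Lemma prU A B : measurable A -> measurable B -> pr (A `|` B) <= pr A + pr B.
Proof.
move=> mA mB; rewrite -lee_fin EFinD -!prE//; last exact: measurableU.
exact: measureU2.
Qed.

Lemma prU_disj A B : measurable A -> measurable B -> A `&` B = set0 ->
  pr (A `|` B) = pr A + pr B.
Proof.
move=> mA mB AB; apply: EFin_inj; rewrite EFinD -!prE//.
  exact: measureU.
exact: measurableU.
Qed.

Lemma prD A B : measurable A -> measurable B -> A `<=` B ->
  pr (B `\` A) = pr B - pr A.
Proof.
move=> mA mB AB.
have <- : A `|` B `\` A = B by rewrite setDUK.
rewrite [in RHS]prU_disj//; last by rewrite setDIK.
  by rewrite setDUK// addrAC subrr add0r.
exact: measurableD.
Qed.

End probability_real.

Section loeb.
Context (R : realType) (d : nat -> measure_display).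
Context (T : forall i, measurableType (d i)) (P : forall i, probability (T i) R).
Implicit Types (F G : forall i, set (T i)).

(* The ultraproduct is not quotiented by equality along omega: all the sets that
   are measured below are saturated for that relation up to null sets. *)
Definition loeb_space (Q : forall i, probability (T i) R) : Type :=
  forall i, T i.

Local Notation Om := (loeb_space P).

Definition internal F : set Om := [set x | \forall i \near omega, F i (x i)].

Definition all_meas F := forall i, measurable (F i).

Lemma internal_setC F x : internal (fun i => ~` F i) x <-> ~ internal F x.
Proof. by rewrite /internal/=; split=> /omega_notP. Qed.

(** If the inclusion fails for omega-many i, the witnesses of failure form one point of the product
    that lies in [internal F] but not in [internal G]. *)
Lemma internal_subset F G :
  internal F `<=` internal G <-> \forall i \near omega, F i `<=` G i.
Proof.
split=> [FG|FG x Fx]; last by apply: filterS2 FG Fx => i; exact.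
apply: contrapT => /omega_notP nFG.
have ex i : exists z : T i, ~ (F i `<=` G i) -> F i z /\ ~ G i z.
  have [|/existsNP[z /not_implyP[Fz Gz]]] := pselect (F i `<=` G i).
    by exists point.
  by exists z.
pose x i := projT1 (cid (ex i)); have xP i := projT2 (cid (ex i)).
have Fx : internal F x by apply: filterS nFG => i /xP[].
by have [i [/xP[_ nGx] Gx]] := omega_ex2 nFG (FG x Fx).
Qed.

(** Null sets precede the measure: they are the sets of outer measure zero with respect to internal
    covers. *)
Definition loeb_null (N : set Om) := forall e : R, 0 < e ->
  exists F, [/\ all_meas F, N `<=` internal F &
    \forall i \near omega, pr (P i) (F i) <= e].

Lemma loeb_nullS N N' : N `<=` N' -> loeb_null N' -> loeb_null N.
Proof.
move=> NN' N0 e /N0[F [mF N'F Fe]]; exists F; split=> //.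
exact: subset_trans N'F.
Qed.

(* Countable saturation: the ultraproduct is an aleph_1-saturated structure, so
   an increasing union of internal sets is covered, without loss of measure, by
   a single internal set. *)
Lemma internal_saturation (F : nat -> forall i, set (T i)) (c : R) :
  (forall n, all_meas (F n)) ->
  (forall n m i, (n <= m)%N -> F n i `<=` F m i) ->
  (forall n e, 0 < e -> \forall i \near omega, pr (P i) (F n i) <= c + e) ->
  exists G, [/\ all_meas G, forall n, internal (F n) `<=` internal G &
    forall e, 0 < e -> \forall i \near omega, pr (P i) (G i) <= c + e].
Proof.
move=> mF ndF Fc.
have [m [Qm mn]] :
    exists m : nat -> nat, (\forall i \near omega,
      pr (P i) (F (m i) i) <= c + (m i).+1%:R^-1) /\
    forall n, \forall i \near omega, (n <= m i)%N.
  apply: (@omega_diag (fun m i => pr (P i) (F m i) <= c + m.+1%:R^-1)) => n.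
  by apply: Fc; rewrite invr_gt0.
exists (fun i => F (m i) i); split=> //.
- by move=> i; exact: mF.
- move=> n x; apply: filterS2 (mn n) => i nm; exact: ndF.
- move=> e e0.
  have [n ne] : exists n : nat, e^-1 <= n.+1%:R.
    by exists (Num.truncn e^-1); apply: ltW; exact: truncnS_gt.
  apply: filterS2 Qm (mn n) => i /le_trans Qmi ni; apply: Qmi.
  rewrite lerD2l -(invrK e) lef_pV2 ?posrE ?invr_gt0//.
  by apply: (le_trans ne); rewrite ler_nat.
Qed.

Lemma pr_bigsetU_geo (F : nat -> forall i, set (T i)) (e : R) (n i : nat) :
  (forall m, all_meas (F m)) -> 0 <= e ->
  (forall m, (m <= n)%N -> pr (P i) (F m i) <= e / 2 ^+ m.+1) ->
  pr (P i) (\big[setU/set0]_(m < n.+1) F m i) <= e * (1 - 2^-1 ^+ n.+1).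
Proof.
move=> mF e0; elim: n => [|n IHn] Fe.
  rewrite big_ord1 expr1; apply: (le_trans (Fe 0%N _)) => //.
  by rewrite expr1; lra.
rewrite big_ord_recr/=; apply: le_trans (prU _ _ _) _.
- by apply: bigsetU_measurable => k _; exact: mF.
- exact: mF.
have IH := IHn (fun m mn => Fe m (leqW mn)).
apply: (le_trans (lerD IH (Fe n.+1 (leqnn _)))).
rewrite [X in _ <= e * (1 - X)]exprS -exprVn [X in _ + e * X]exprS.
by lra.
Qed.

(** Covers of size e / 2 / 2^(n + 1) have finite unions of size at most e / 2. Their infinite union
    need not be internal, so saturation supplies one internal cover, at the price of the other e /
    2. *)
Lemma loeb_null_bigcup (N : nat -> set Om) :
  (forall n, loeb_null (N n)) -> loeb_null (\bigcup_n N n).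
Proof.
move=> N0 e e0.
have e2 : 0 < e / 2 by lra.
have /choice[F FP] n : exists F, [/\ all_meas F, N n `<=` internal F &
    \forall i \near omega, pr (P i) (F i) <= e / 2 / 2 ^+ n.+1].
  by apply: N0; rewrite divr_gt0// exprn_gt0.
pose H n i := \big[setU/set0]_(m < n.+1) F m i.
have mF n : all_meas (F n) by have [] := FP n.
have [||n e' e'0|G [mG HG Ge]] := @internal_saturation H (e / 2).
- by move=> n i; apply: bigsetU_measurable => k _; exact: mF.
- by move=> n m i nm; exact: (@subset_bigsetU _ (fun k => F k i) n.+1 m.+1).
- have : \forall i \near omega, forall m, (m <= n)%N ->
      pr (P i) (F m i) <= e / 2 / 2 ^+ m.+1.
    elim: n => [|n IHn].
      by have [_ _] := FP 0%N; apply: filterS => i ? m; rewrite leqn0 => /eqP ->.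
    have [_ _] := FP n.+1; apply: filterS2 IHn => i IH ? m.
    by rewrite leq_eqVlt ltnS => /predU1P[->//|]; exact: IH.
  apply: filterS => i Fi.
  apply: (le_trans (pr_bigsetU_geo mF (ltW e2) Fi)).
  have : 0 <= (2^-1 : R) ^+ n.+1 by rewrite exprn_ge0// invr_ge0.
  by move: (_ ^+ _) => z z0; nra.
exists G; split=> //.
- move=> x [n _ Nx]; apply: (HG n).
  have [_ /(_ _ Nx) + _] := FP n; apply: filterS => i Fx.
  by rewrite /H big_ord_recr/=; right.
- by apply: filterS (Ge _ e2) => i; rewrite -splitr.
Qed.

Lemma loeb_nullU N N' : loeb_null N -> loeb_null N' -> loeb_null (N `|` N').
Proof.
move=> N0 N'0; rewrite -bigcup2E; apply: loeb_null_bigcup => -[//|[//|n]] /=.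
move=> e e0; exists (fun=> set0); split=> //.
by apply: nearW => i; rewrite pr_set0 ltW.
Qed.

Definition loeb_approx (E : set Om) F :=
  all_meas F /\ loeb_null [set x | ~ (E x <-> internal F x)].

Definition loeb_measurable (E : set Om) := exists F, loeb_approx E F.

Lemma loeb_null0 : loeb_null set0.
Proof.
move=> e e0; exists (fun=> set0); split=> //.
by apply: nearW => i; rewrite pr_set0 ltW.
Qed.

Lemma internal_approx F : all_meas F -> loeb_approx (internal F) F.
Proof. by move=> mF; split=> //; apply: loeb_nullS loeb_null0 => x /=; apply. Qed.

(** A cover of an internal set by an internal set is an inclusion in omega-many factors, so
    smallness passes to the factors. *)
Lemma loeb_null_internal F : all_meas F -> loeb_null (internal F) ->
  forall e, 0 < e -> \forall i \near omega, pr (P i) (F i) <= e.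
Proof.
move=> mF F0 e /F0[G [mG /internal_subset FG]].
by apply: filterS2 FG => i FG; apply: le_trans; exact: pr_le.
Qed.

Lemma cvg_pr F : all_meas F ->
  (fun i => pr (P i) (F i)) @ omega --> ulim (fun i => pr (P i) (F i)).
Proof.
move=> mF; apply: (@cvg_ulim _ _ 1); apply: nearW => i.
by rewrite ger0_norm ?pr_ge0// pr_le1.
Qed.

Lemma internal0 : internal (fun=> set0) = set0.
Proof. by apply/seteqP; split=> // x /= /filter_ex[]. Qed.

Lemma internalT : internal (fun=> setT) = setT.
Proof. by apply/seteqP; split=> // x _; exact: nearW. Qed.

Lemma loeb_approx0 : loeb_approx set0 (fun=> set0).
Proof. by rewrite -internal0; exact: internal_approx. Qed.

Lemma loeb_approxC E F : loeb_approx E F -> loeb_approx (~` E) (fun i => ~` F i).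
Proof.
move=> [mF EF]; split; first by move=> i; exact: measurableC.
apply: loeb_nullS EF => x /= nEF EF; apply: nEF.
by rewrite internal_setC EF.
Qed.

Lemma loeb_approxU E F E' F' : loeb_approx E F -> loeb_approx E' F' ->
  loeb_approx (E `|` E') (fun i => F i `|` F' i).
Proof.
move=> [mF EF] [mF' EF']; split; first by move=> i; exact: measurableU.
apply: loeb_nullS (loeb_nullU EF EF') => x /= nEF.
apply: contrapT => /not_orP[/contrapT E1 /contrapT E2]; apply: nEF.
split=> [[/E1|/E2]|].
- by apply: filterS => i; left.
- by apply: filterS => i; right.
- by move=> /omega_or[/E1|/E2]; [left|right].
Qed.

(* The measure of the union is the supremum of the measures of the partial
   unions, because saturation provides an internal set approximating it. *)
Lemma loeb_approx_bigcup (E : nat -> set Om) (F : nat -> forall i, set (T i)) :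
  (forall n, loeb_approx (E n) (F n)) ->
  (forall n m i, (n <= m)%N -> F n i `<=` F m i) ->
  exists2 G, loeb_approx (\bigcup_n E n) G &
    forall e, 0 < e -> exists n, forall m, (n <= m)%N ->
      `|ulim (fun i => pr (P i) (F m i)) - ulim (fun i => pr (P i) (G i))| <= e.
Proof.
move=> EF ndF.
have mF n : all_meas (F n) by have [] := EF n.
pose a n := ulim (fun i => pr (P i) (F n i)).
have nda : {homo a : n m / (n <= m)%N >-> n <= m}.
  move=> n m nm; apply: cvg_omega_le (cvg_pr (mF n)) _ => e e0.
  have ae : a m < a m + e by rewrite ltrDl.
  apply: filterS (cvg_omega_ub (cvg_pr (mF m)) ae) => i /ltW; apply: le_trans.
  by apply: pr_le; [exact: mF|exact: mF|exact: ndF].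
have a1 n : a n <= 1.
  apply: cvg_omega_le (cvg_pr (mF n)) _ => e e0; apply: nearW => i.
  by apply: (le_trans (pr_le1 _ (mF n i))); lra.
have hs : has_sup (range a).
  by split; [exists (a 0%N), 0%N|exists 1 => _ [n _ <-]].
pose s := sup (range a).
have as' n : a n <= s by apply: sup_upper_bound => //; exists n.
have sa e : 0 < e -> exists n, s - e < a n.
  by move=> e0; have [_ [n _ <-] ?] := sup_adherent e0 hs; exists n.
have [|G [mG FG Ge]] := internal_saturation mF ndF (c := s).
  move=> n e e0; have ae : a n < s + e by have := as' n; lra.
  by apply: filterS (cvg_omega_ub (cvg_pr (mF n)) ae) => i /ltW.
have Gs : ulim (fun i => pr (P i) (G i)) = s.
  apply/eqP; rewrite eq_le; apply/andP; split.
    exact: cvg_omega_le (cvg_pr mG) Ge.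
  apply: sup_le_ub; first exact: hs.1.
  move=> _ [n _ <-]; apply: cvg_omega_le (cvg_pr (mF n)) _ => e e0.
  have Gs : ulim (fun i => pr (P i) (G i)) < ulim (fun i => pr (P i) (G i)) + e.
    by rewrite ltrDl.
  apply: filterS2 ((internal_subset _ _).1 (FG n))
    (cvg_omega_ub (cvg_pr mG) Gs) => i FGi /ltW; apply: le_trans.
  by apply: pr_le; [exact: mF|exact: mG|].
exists G; last first.
  move=> e /sa[n sn]; exists n => m nm; rewrite Gs -/(a m).
  by rewrite ler_norml; have := as' m; have := nda _ _ nm; lra.
split=> //.
have EF0 : loeb_null (\bigcup_n [set x | ~ (E n x <-> internal (F n) x)]).
  by apply: loeb_null_bigcup => n; have [] := EF n.
(* [G] has measure at most s up to any slack and contains every [F n], whose measures approach s;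
   what is left over has arbitrarily small measure. *)
have GF0 : loeb_null (internal G `\` \bigcup_n internal (F n)).
  move=> e e0; have e20 : 0 < e / 2 by lra.
  have [n sn] := sa _ e20.
  exists (fun i => G i `\` F n i); split.
  - by move=> i; apply: measurableD; [exact: mG|exact: mF].
  - move=> x [Gx nFx]; have : ~ internal (F n) x by move=> Fx; apply: nFx; exists n.
    by move=> /internal_setC; apply: filterS2 Gx.
  - apply: filterS3 ((internal_subset _ _).1 (FG n)) (Ge _ e20)
      (cvg_omega_lb (cvg_pr (mF n)) sn) => i FGi Gi Fi.
    by rewrite prD//; [lra|exact: mF].
apply: loeb_nullS (loeb_nullU EF0 GF0) => x /= EG.
have [[n _ xn]|nEF] := pselect ((\bigcup_n [set x | ~ (E n x <-> internal (F n) x)]) x).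
  by left; exists n.
have {}nEF n : E n x <-> internal (F n) x.
  by apply: contrapT => nE; apply: nEF; exists n.
right; apply: contrapT => nGF; apply: EG; split=> [[n _ /nEF]|Gx].
  exact: FG.
apply: contrapT => nE; apply: nGF; split=> // -[n _ Fx].
by apply: nE; exists n => //; exact/nEF.
Qed.

Lemma loeb_measurableC E : loeb_measurable E -> loeb_measurable (~` E).
Proof. by move=> [F EF]; exists (fun i => ~` F i); exact: loeb_approxC. Qed.

Lemma loeb_approx_bigsetU (E : nat -> set Om) (F : nat -> forall i, set (T i)) n :
  (forall n, loeb_approx (E n) (F n)) ->
  loeb_approx (\big[setU/set0]_(k < n) E k)
    (fun i => \big[setU/set0]_(k < n) F k i).
Proof.
move=> EF; elim: n => [|n IHn].
  rewrite big_ord0 [X in loeb_approx _ X](_ : _ = fun=> set0).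
    exact: loeb_approx0.
  by apply: functional_extensionality_dep => i; rewrite big_ord0.
rewrite big_ord_recr [X in loeb_approx _ X]
  (_ : _ = fun i => \big[setU/set0]_(k < n) F k i `|` F n i).
  exact: loeb_approxU.
by apply: functional_extensionality_dep => i; rewrite big_ord_recr.
Qed.

Lemma bigcup_bigsetU (X : Type) (E : nat -> set X) :
  \bigcup_n \big[setU/set0]_(k < n) E k = \bigcup_n E n.
Proof.
apply/seteqP; split=> [x [n _]|x [n _ En]].
  by rewrite -bigcup_mkord => -[k _ Ek]; exists k.
by exists n.+1 => //; rewrite big_ord_recr/=; right.
Qed.

Lemma loeb_measurable_bigcup (E : nat -> set Om) :
  (forall n, loeb_measurable (E n)) -> loeb_measurable (\bigcup_n E n).
Proof.
move=> /choice[F EF]; rewrite -bigcup_bigsetU.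
have [||G EG _] := @loeb_approx_bigcup (fun n => \big[setU/set0]_(k < n) E k)
  (fun n i => \big[setU/set0]_(k < n) F k i).
- by move=> n; exact: loeb_approx_bigsetU.
- by move=> n m i nm; exact: (@subset_bigsetU _ (fun k => F k i) n m).
- by exists G.
Qed.

HB.instance Definition _ := Pointed.copy (loeb_space P) (forall i, T i).

HB.instance Definition _ := @isMeasurable.Build default_measure_display
  (loeb_space P) loeb_measurable (ex_intro _ _ loeb_approx0)
  loeb_measurableC loeb_measurable_bigcup.

(** The internal difference of two approximants lies in the union of their exceptional sets, hence
    has infinitesimal measure. *)
Lemma loeb_approx_uniq E F G : loeb_approx E F -> loeb_approx E G ->
  ulim (fun i => pr (P i) (F i)) = ulim (fun i => pr (P i) (G i)).
Proof.
suff le F' G' : loeb_approx E F' -> loeb_approx E G' ->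
    ulim (fun i => pr (P i) (F' i)) <= ulim (fun i => pr (P i) (G' i)).
  by move=> EF EG; apply/eqP; rewrite eq_le !le.
move=> [mF EF] [mG EG]; apply: cvg_omega_le (cvg_pr mF) _ => e e0.
have e20 : 0 < e / 2 by lra.
have mFG : all_meas (fun i => F' i `\` G' i) by move=> i; exact: measurableD.
have Ge : ulim (fun i => pr (P i) (G' i)) < ulim (fun i => pr (P i) (G' i)) + e / 2.
  by rewrite ltrDl.
apply: filterS2 (cvg_omega_ub (cvg_pr mG) Ge) (loeb_null_internal mFG _ e20).
  move=> i Gi FGi; have : pr (P i) (F' i) <= pr (P i) (G' i `|` (F' i `\` G' i)).
    apply: pr_le => //; first exact: measurableU.
    by move=> z Fz; have [Gz|nGz] := pselect (G' i z); [left|right].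
  by move=> /le_trans/(_ (prU _ (mG i) (mFG i))); lra.
apply: loeb_nullS (loeb_nullU EF EG) => x FGx; apply: contrapT.
move=> /not_orP[/contrapT E1 /contrapT E2].
have Fx : internal F' x by apply: filterS FGx => i [].
have : internal (fun i => ~` G' i) x by apply: filterS FGx => i [].
by rewrite internal_setC -E2 E1.
Qed.

(** The approximant is picked by choice; [loeb_approx_uniq] makes the value independent of it. Off
    the sigma-algebra 0 is a default. *)
Definition loeb_measure (E : set Om) : \bar R :=
  if pselect (loeb_measurable E) is left ME
  then (ulim (fun i => pr (P i) (projT1 (cid ME) i)))%:E else 0%E.

Lemma loeb_measureE E F : loeb_approx E F ->
  loeb_measure E = (ulim (fun i => pr (P i) (F i)))%:E.
Proof.
move=> EF; rewrite /loeb_measure; case: pselect => [ME|nME].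
  by congr (_%:E); apply: loeb_approx_uniq EF; exact: projT2 (cid ME).
by exfalso; apply: nME; exists F.
Qed.

Lemma loeb_measure0 : loeb_measure set0 = 0%E.
Proof.
rewrite (loeb_measureE loeb_approx0); congr (_%:E).
apply: (@cvg_omega_uniq _ (fun i => pr (P i) set0)).
  by apply: (@cvg_pr (fun i => set0)) => i.
rewrite [X in X @ omega --> _](_ : _ = cst 0); first exact: cvg_cst.
by apply/funext => i; rewrite pr_set0.
Qed.

Lemma loeb_measure_ge0 E : (0 <= loeb_measure E)%E.
Proof.
rewrite /loeb_measure; case: pselect => // ME.
case: cid => F [mF _] /=; rewrite lee_fin.
apply: cvg_omega_ge (cvg_pr mF) _ => e e0; apply: nearW => i.
by have := pr_ge0 (P i) (F i); lra.
Qed.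

(** Approximants of disjoint sets are disjoint only up to an infinitesimal overlap, which is cut out
    before adding. *)
Lemma loeb_measureU E E' : loeb_measurable E -> loeb_measurable E' ->
  E `&` E' = set0 ->
  loeb_measure (E `|` E') = (loeb_measure E + loeb_measure E')%E.
Proof.
move=> [F EF] [F' EF'] EE'.
rewrite (loeb_measureE (loeb_approxU EF EF')) (loeb_measureE EF) (loeb_measureE EF').
rewrite -EFinD; congr (_%:E).
have [[mF F0] [mF' F'0]] := (EF, EF').
have mFF' : all_meas (fun i => F i `&` F' i) by move=> i; exact: measurableI.
have FF'0 : loeb_null (internal (fun i => F i `&` F' i)).
  apply: loeb_nullS (loeb_nullU F0 F'0) => x FFx; apply: contrapT.
  move=> /not_orP[/contrapT E1 /contrapT E2].
  have Fx : internal F x by apply: filterS FFx => i [].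
  have Fx' : internal F' x by apply: filterS FFx => i [].
  have : (E `&` E') x by split; [exact/E1|exact/E2].
  by rewrite EE'.
apply: cvg_omega_uniq (cvg_pr _) _; first by move=> i; exact: measurableU.
apply/cvg_omega_norm => e e0; have e30 : 0 < e / 3 by lra.
apply: filterS3 ((cvg_omega_norm _ _).1 (cvg_pr mF) _ e30)
  ((cvg_omega_norm _ _).1 (cvg_pr mF') _ e30)
  (loeb_null_internal mFF' FF'0 e30) => i Fi Fi' FFi.
have -> : F i `|` F' i = F i `|` (F' i `\` (F i `&` F' i)).
  apply/seteqP; split=> z [Fz|]; [by left| |by left|by move=> []; right].
  by have [|nFz] := pselect (F i z); [left|right; split=> // -[]].
rewrite prU_disj//; last 2 first.
- exact: measurableD.
- by apply/seteqP; split=> z // -[Fz [Fz' nFz]]; exfalso; exact: nFz.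
rewrite prD//.
move: Fi Fi' FFi (pr_ge0 (P i) (F i `&` F' i)); rewrite !ler_norml.
lra.
Qed.

(** Finite additivity turns the partial sums into measures of partial unions, and
    [loeb_approx_bigcup] is continuity from below. *)
Lemma loeb_measure_sigma_additive : semi_sigma_additive loeb_measure.
Proof.
move=> E mE tE _.
have /choice[F EF] := mE.
have mU n : loeb_approx (\big[setU/set0]_(k < n) E k)
    (fun i => \big[setU/set0]_(k < n) F k i) by exact: loeb_approx_bigsetU.
have -> : (fun n => \sum_(0 <= k < n) loeb_measure (E k))%E =
    fun n => loeb_measure (\big[setU/set0]_(k < n) E k).
  apply/funext => n; elim: n => [|n IHn].
    by rewrite big_geq// big_ord0 loeb_measure0.
  rewrite big_nat_recr//= IHn big_ord_recr/= loeb_measureU//.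
  - by eexists; exact: mU.
  - exact: mE.
  - have tE' : trivIset [set` predT] E by rewrite set_true.
    exact: (@trivIset_bigsetUI _ predT E tE' n n isT (leqnn n)).
have [|G EG Gn] := loeb_approx_bigcup mU.
  by move=> n m i nm; exact: (@subset_bigsetU _ (fun k => F k i) n m).
rewrite -bigcup_bigsetU (loeb_measureE EG).
under eq_fun do rewrite (loeb_measureE (mU _)).
apply: cvg_EFin; first exact: nearW.
apply/cvgrPdist_le => e /Gn[n nG]; exists n => // m /= /nG.
by rewrite distrC.
Qed.

HB.instance Definition _ := isMeasure.Build _ _ _ loeb_measure
  loeb_measure0 loeb_measure_ge0 loeb_measure_sigma_additive.

Lemma loeb_measure_setT : loeb_measure setT = 1%E.
Proof.
have TT : loeb_approx setT (fun=> setT).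
  by rewrite -internalT; apply: internal_approx => i; exact: measurableT.
rewrite (loeb_measureE TT); congr (_%:E).
apply: (@cvg_omega_uniq _ (fun i => pr (P i) setT)).
  by apply: (@cvg_pr (fun i => setT)) => i; exact: measurableT.
rewrite [X in X @ omega --> _](_ : _ = cst 1); first exact: cvg_cst.
by apply/funext => i; rewrite pr_setT.
Qed.

HB.instance Definition _ := Measure_isProbability.Build _ _ _ loeb_measure
  loeb_measure_setT.

Definition loeb_prob : probability Om R := loeb_measure.

End loeb.

Arguments loeb_measure {R d T} P E.
Arguments loeb_prob {R d T} P.
Arguments internal {R d T} P F.

(** * Limits of random variables *)

Lemma measurable_gt (R : realType) (d : measure_display) (T : measurableType d)
    (f : T -> R) t : measurable_fun setT f -> measurable [set x | t < f x].
Proof.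
move=> mf; rewrite [X in measurable X](_ : _ = setT `&` f @^-1` `]t, +oo[).
  exact: mf.
by apply/seteqP; split=> z /=; rewrite in_itv/= andbT// => -[].
Qed.

Lemma measurable_le (R : realType) (d : measure_display) (T : measurableType d)
    (f : T -> R) t : measurable_fun setT f -> measurable [set x | f x <= t].
Proof.
move=> mf; rewrite [X in measurable X](_ : _ = ~` [set x | t < f x]).
  by apply: measurableC; exact: measurable_gt.
by apply/seteqP; split=> z /=; rewrite leNgt => /negP.
Qed.

Lemma markov_ge0 (R : realType) (d : measure_display) (T : measurableType d)
    (P : probability T R) (f : T -> R) (M : R) :
  measurable_fun setT f -> (forall z, 0 <= f z) -> 0 <= M ->
  (M%:E * P [set z | (M < f z)%R] <= \int[P]_z (f z)%:E)%E.
Proof.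
move=> mf f0 M0.
have mA := measurable_gt M mf.
rewrite -integral_cst//.
have mfE : measurable_fun setT (EFin \o f) by exact/measurable_EFinP.
apply: (@le_trans _ _ (\int[P]_(z in [set z | (M < f z)%R]) (f z)%:E)%E).
  apply: ge0_le_integral => //.
  - exact: (measurable_funS measurableT).
  - by move=> z /= /ltW; rewrite lee_fin.
apply: ge0_subset_integral => //.
by move=> z _; rewrite lee_fin.
Qed.

Section internal_limits.
Context (R : realType) (d : nat -> measure_display).
Context (T : forall i, measurableType (d i)) (P : forall i, probability (T i) R).
Implicit Types (F G : forall i, set (T i)) (g h : forall i, T i -> R).

Local Notation Om := (loeb_space P).
Local Notation mu := (loeb_prob P).

Lemma measurable_internal F : all_meas F -> measurable (internal P F).
Proof. by move=> mF; exists F; exact: internal_approx. Qed.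

Lemma cvg_internal F : all_meas F ->
  (fun i => pr (P i) (F i)) @ omega --> pr mu (internal P F).
Proof.
move=> mF; rewrite /pr/= (loeb_measureE (internal_approx P mF)) /=.
exact: cvg_pr.
Qed.

Lemma loeb_null_negligible (N : set Om) : loeb_null N -> mu.-negligible N.
Proof.
move=> N0.
have N0' : loeb_approx N (fun=> set0).
  split=> //; apply: loeb_nullS N0 => x /=; rewrite internal0.
  by move=> nN; apply: contrapT => Nx; apply: nN.
exists N; split=> //; first by exists (fun=> set0).
by rewrite /= (loeb_measureE N0') -(loeb_measureE (loeb_approx0 P)) loeb_measure0.
Qed.

Lemma measurable_loebP (E : set Om) : measurable E ->
  exists2 F, all_meas F & {ae mu, forall x : Om, E x <-> internal P F x}.
Proof. by move=> [F [mF EF]]; exists F => //; exact: loeb_null_negligible. Qed.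

(** The exceptional null sets of the factors assemble into one internal set of measure zero. *)
Lemma ae_internal (Q : forall i, T i -> Prop) :
  (\forall i \near omega, \forall z \ae P i, Q i z) ->
  {ae mu, forall x : Om, \forall i \near omega, Q i (x i)}.
Proof.
move=> Qae.
have ex i : exists N : set (T i), measurable N /\ ((\forall z \ae P i, Q i z) ->
    P i N = 0%E /\ ~` [set z | Q i z] `<=` N).
  have [[N [mN N0 QN]]|nQ] := pselect (\forall z \ae P i, Q i z).
    by exists N.
  by exists set0; split.
pose N i := projT1 (cid (ex i)); have NP i := projT2 (cid (ex i)).
have mN : all_meas N by move=> i; exact: (NP i).1.
apply: loeb_null_negligible => e e0; exists N; split=> //.
- move=> x /= /omega_notP nQ; apply: filterS2 nQ Qae => i nQ.
  by move=> /(NP i).2[_]; exact.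
- by apply: filterS Qae => i /(NP i).2[N0 _]; rewrite /pr N0 ltW.
Qed.

Definition ibounded g (x : Om) :=
  exists M : R, \forall i \near omega, `|g i (x i)| <= M.

Definition all_mfun g := forall i, measurable_fun setT (g i).

Lemma all_meas_gt g t : all_mfun g -> all_meas (fun i => [set z | t < g i z]).
Proof. by move=> mg i; exact: measurable_gt. Qed.

Lemma all_meas_le g t : all_mfun g -> all_meas (fun i => [set z | g i z <= t]).
Proof. by move=> mg i; exact: measurable_le. Qed.

Lemma all_mfun_norm g : all_mfun g -> all_mfun (fun i z => `|g i z|).
Proof. by move=> mg i; exact: measurableT_comp. Qed.

Lemma measurable_ibounded g : all_mfun g -> measurable (ibounded g).
Proof.
move=> mg; rewrite [X in measurable X](_ : _ =
    \bigcup_n internal P (fun i => [set z | `|g i z| <= n%:R])).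
  apply: bigcupT_measurable => n; apply: measurable_internal.
  exact: (all_meas_le _ (all_mfun_norm mg)).
apply/seteqP; split=> [x [M gM]|x [n _ gn]]; last by exists n%:R.
exists (Num.truncn M).+1 => //; apply: filterS gM => i /= /le_trans; apply.
by apply: ltW; exact: truncnS_gt.
Qed.

Lemma cvg_ibounded g x : ibounded g x ->
  (fun i => g i (x i)) @ omega --> ulim (fun i => g i (x i)).
Proof. by move=> [M gM]; exact: (@cvg_ulim _ _ M). Qed.

(* The standard part of an internal function, 0 where it is infinite. *)
Definition istd g (x : Om) : R :=
  if pselect (ibounded g x) then ulim (fun i => g i (x i)) else 0.

Lemma cvg_istd g x : ibounded g x -> (fun i => g i (x i)) @ omega --> istd g x.
Proof. by rewrite /istd; case: pselect => // bg _; exact: cvg_ibounded. Qed.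

Lemma measurable_istd g : all_mfun g -> measurable_fun setT (istd g).
Proof.
move=> mg; apply: (measurability _ (RGenOInfty.measurableE R)).
move=> _ [_ [t ->] <-]; rewrite setTI.
have mB := measurable_ibounded mg.
(* Since t < g i yields only t <= limit, strictness is witnessed by a margin 1 / (n + 1). The second
   part accounts for the default value 0 where [g] is infinite. *)
rewrite [X in measurable X](_ : _ = (ibounded g `&`
    \bigcup_n internal P (fun i => [set z | t + n.+1%:R^-1 < g i z])) `|`
    (~` ibounded g `&` [set x | t < 0])).
  apply: measurableU.
    apply: measurableI => //; apply: bigcupT_measurable => n.
    by apply: measurable_internal; exact: all_meas_gt.
  apply: measurableI; first exact: measurableC.
  have [t0|t0] := pselect (t < 0).
    rewrite [X in measurable X](_ : _ = setT)//.
    by apply/seteqP; split.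
  rewrite [X in measurable X](_ : _ = set0)//.
  by apply/seteqP; split.
apply/seteqP; split=> x /=; rewrite in_itv/= andbT.
- have [bx|nbx] := pselect (ibounded g x); last first.
    by rewrite /istd; case: pselect => // nb' t0; right; split.
  move=> tg; left; split=> //.
  have gt0 : 0 < istd g x - t by rewrite subr_gt0.
  exists (Num.truncn (istd g x - t)^-1) => //.
  apply: (cvg_omega_lb (cvg_istd bx)).
  rewrite addrC -ltrBrDr invf_plt ?posrE//.
  exact: truncnS_gt.
- move=> [[bx [n _ gn]]|[nbx t0]]; last by rewrite /istd; case: pselect.
  apply: (@lt_le_trans _ _ (t + n.+1%:R^-1)); first by rewrite ltrDl invr_gt0.
  apply: cvg_omega_ge (cvg_istd bx) _ => e e0.
  by apply: filterS gn => i /ltW; apply: le_trans; rewrite lerBlDr lerDl ltW.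
Qed.

(** In the language of nonstandard analysis, [g] is a lifting of [g0]. *)
Definition icvg g (g0 : Om -> R) :=
  {ae mu, forall x : Om, (fun i => g i (x i)) @ omega --> g0 x}.

Lemma pr_le_ae (A B : set Om) : measurable A -> measurable B ->
  (\forall x \ae mu, A x -> B x) -> pr mu A <= pr mu B.
Proof.
move=> mA mB [N [mN N0 AB]].
have : pr mu A <= pr mu (B `|` N).
  apply: pr_le => //; first exact: measurableU.
  move=> x Ax; have [|nN] := pselect (N x); first by right.
  by left; apply: contrapT => nB; apply: nN; apply: AB => /(_ Ax).
by move=> /le_trans/(_ (prU _ mB mN)); rewrite [X in _ + X]/pr N0 addr0.
Qed.

Lemma pr_eq0_ae (A : set Om) : measurable A -> (forall e, 0 < e -> pr mu A <= e) ->
  mu.-negligible A.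
Proof.
move=> mA A0; apply/negligibleP => //; apply: etrans (prE mu mA) _; congr (_%:E).
apply/eqP; rewrite eq_le pr_ge0 andbT; apply/ler_addgt0Pr => e e0.
by rewrite add0r; exact: A0.
Qed.

Lemma ae_ibounded g (c : R) : all_mfun g ->
  (\forall i \near omega, (\int[P i]_z `|g i z|%:E <= c%:E)%E) ->
  {ae mu, forall x : Om, ibounded g x}.
Proof.
move=> mg gc; apply: pr_eq0_ae; first exact/measurableC/measurable_ibounded.
move=> e e0.
(* By Markov's inequality the set where [|g i| > M] has measure at most c / M <= e; the added 1
   keeps M positive. *)
pose M := (`|c| + 1) / e.
have M0 : 0 < M by rewrite divr_gt0// ltr_wpDl.
have mgt := all_meas_gt M (all_mfun_norm mg).
apply: (@le_trans _ _ (pr mu (internal P (fun i => [set z | M < `|g i z|])))).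
  apply: pr_le; [exact/measurableC/measurable_ibounded|
    exact: measurable_internal|].
  move=> x nb; apply: contrapT => /omega_notP nM; apply: nb; exists M.
  by apply: filterS nM => i /= /negP; rewrite -leNgt.
apply: cvg_omega_le (cvg_internal mgt) _ => e' e'0; apply: filterS gc => i gc.
suff : pr (P i) [set z | M < `|g i z|] <= e by lra.
rewrite -lee_fin -prE; last exact: mgt.
have := @markov_ge0 _ _ _ (P i) (fun z => `|g i z|) M (@all_mfun_norm g mg i)
  (fun z => normr_ge0 (g i z)) (ltW M0).
move=> /le_trans/(_ gc) H.
rewrite -(@lee_pmul2l _ M%:E)//.
apply: (le_trans H); rewrite -EFinM lee_fin /M divfK ?gt_eqF//.
by rewrite (le_trans (ler_norm c))// lerDl.
Qed.

(** * Fatou's lemma along the ultrafilter *)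

Lemma integral_steps (d' : measure_display) (T' : measurableType d')
    (Q : probability T' R) (A : nat -> set T') (a : R) (K : nat) :
  (forall k, measurable (A k)) -> 0 <= a ->
  (\int[Q]_z (a * \sum_(k < K) \1_(A k) z)%:E =
   (a * \sum_(k < K) pr Q (A k))%:E)%E.
Proof.
move=> mA a0.
under eq_integral => z _ do rewrite mulr_sumr -sumEFin.
rewrite ge0_integral_sum//; last 2 first.
- by move=> k; apply/measurable_EFinP; apply: measurable_funM.
- by move=> k z _; rewrite lee_fin mulr_ge0.
rewrite mulr_sumr -sumEFin; apply: eq_bigr => k _.
under eq_integral => z _ do rewrite EFinM.
rewrite ge0_integralZl//.
- by rewrite integral_indic// setIT EFinM; congr (_ * _)%E; exact: prE.
- by apply/measurable_EFinP.
Qed.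

(** A lower sum of the layer-cake formula with mesh a and K levels. Its integral is a finite
    combination of measures of superlevel sets, whose limits along [omega] are given by
    [cvg_internal]. *)
Definition steps (a : R) (K : nat) (y : R) : R :=
  a * \sum_(k < K) (k.+1%:R * a < y)%R%:R.

Lemma steps_le a K y : 0 <= a -> 0 <= y -> steps a K y <= y.
Proof.
move=> a0 y0; rewrite /steps.
suff : a * \sum_(k < K) (k.+1%:R * a < y)%R%:R <= Num.min y (K%:R * a).
  by rewrite le_min => /andP[].
elim: K => [|K IH]; first by rewrite big_ord0 mulr0 le_min y0 mul0r lexx.
rewrite big_ord_recr/= mulrDr; move: IH; rewrite !le_min => /andP[IH1 IH2].
have KE : K.+1%:R * a = K%:R * a + a by rewrite -natr1 mulrDl mul1r.
have [ltKy|_] := ltP; rewrite ?mulr1 ?mulr0 ?addr0 KE; apply/andP; split; lra.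
Qed.

Lemma steps_ge a K y : 0 <= a -> Num.min y (K.+1%:R * a) <= steps a K y + a.
Proof.
move=> a0; rewrite /steps.
elim: K => [|K IH].
  by rewrite big_ord0 mulr0 add0r ge_min mul1r lexx orbT.
rewrite big_ord_recr/= mulrDr.
have KE : K.+2%:R * a = K.+1%:R * a + a by rewrite -[X in X * a]natr1 mulrDl mul1r.
have KE' : K.+1%:R * a = K%:R * a + a by rewrite -natr1 mulrDl mul1r.
have [ltKy|geKy] := ltP; rewrite ?mulr1 ?mulr0 ?addr0.
  suff : K%:R * a <= a * \sum_(k < K) (k.+1%:R * a < y)%R%:R.
    by rewrite ge_min KE; move=> ?; apply/orP; right; lra.
  rewrite mulrC ler_wpM2l// (eq_bigr (fun=> 1)).
    by rewrite sumr_const card_ord.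
  move=> k _; rewrite (_ : _ < _)//; apply: le_lt_trans ltKy.
  by rewrite ler_wpM2r// ler_nat ltnS ltnW.
by move: IH; rewrite (min_idPl geKy) => IH; rewrite ge_min IH.
Qed.

End internal_limits.

Lemma cvg_omega_sum (R : realType) (f : nat -> nat -> R) (l : nat -> R) (K : nat) :
  (forall k, f k @ omega --> l k) ->
  (fun i => \sum_(k < K) f k i) @ omega --> \sum_(k < K) l k.
Proof.
move=> fl; elim: K => [|K IH].
  rewrite big_ord0 [X in X @ omega --> _](_ : _ = cst 0); first exact: cvg_cst.
  by apply/funext => i; rewrite big_ord0.
rewrite big_ord_recr [X in X @ omega --> _]
  (_ : _ = (fun i => \sum_(k < K) f k i) \+ f K); first exact: cvgD.
by apply/funext => i; rewrite big_ord_recr.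
Qed.

(** The mesh 1 / (n + 1) tends to 0, while (n + 1)^2 levels reach up to n + 1, so every y is
    eventually in range. *)
Lemma steps_cvg (R : realType) (y : R) : 0 <= y ->
  steps n.+1%:R^-1 (n.+1 * n.+1) y @[n --> \oo] --> y.
Proof.
move=> y0; apply/cvgrPdist_le => e e0.
exists (maxn (Num.truncn y).+1 (Num.truncn e^-1).+1) => // n.
rewrite [X in X -> _]/= geq_max => /andP[yn en].
have a0 : 0 <= n.+1%:R^-1 :> R by rewrite invr_ge0.
have ae : n.+1%:R^-1 <= e.
  rewrite -(invrK e) lef_pV2 ?posrE ?invr_gt0//.
  apply: ltW; apply: lt_le_trans (truncnS_gt _) _.
  by rewrite ler_nat ltnW.
have yK : y <= (n.+1 * n.+1).+1%:R * n.+1%:R^-1.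
  rewrite ler_pdivlMr//; apply: (@le_trans _ _ (n.+1%:R * n.+1%:R)).
    rewrite ler_wpM2r//; apply: ltW; apply: lt_le_trans (truncnS_gt _) _.
    by rewrite ler_nat ltnW.
  by rewrite -natrM ler_nat.
have := steps_ge (n.+1 * n.+1) y a0; rewrite (min_idPl yK) => ge.
have le := steps_le (n.+1 * n.+1) a0 y0.
move: ge le ae; set z := steps _ _ _; move: (n.+1%:R^-1) => b ge le ae.
by rewrite ger0_norm; lra.
Qed.

Lemma limn_einf_le (R : realType) (u : (\bar R)^nat) (c : \bar R) :
  (forall n, u n <= c)%E -> (limn_einf u <= c)%E.
Proof.
move=> uc; rewrite limn_einf_lim; apply: lime_le; first exact: is_cvg_einfs.
apply: nearW => n; apply: le_trans (uc n); apply: ereal_inf_lbound.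
by exists n => //=.
Qed.

Section limits_of_integrals.
Context (R : realType) (d : nat -> measure_display).
Context (T : forall i, measurableType (d i)) (P : forall i, probability (T i) R).
Implicit Types (g h : forall i, T i -> R).

Local Notation Om := (loeb_space P).
Local Notation mu := (loeb_prob P).

Lemma integral_stepsE (d' : measure_display) (T' : measurableType d')
    (Q : probability T' R) (f : T' -> R) (a : R) (K : nat) :
  measurable_fun setT f -> 0 <= a ->
  (\int[Q]_x (steps a K (f x))%:E =
   (a * \sum_(k < K) pr Q [set x | (k.+1%:R * a < f x)%R])%:E)%E.
Proof.
move=> mf a0.
rewrite -(integral_steps Q (A := fun k => [set x | k.+1%:R * a < f x]))//.
  apply: eq_integral => x _; congr (_ * _)%:E; apply: eq_bigr => k _.
  by rewrite indicE; congr (nat_of_bool _)%:R; apply/idP/idP; rewrite inE.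
by move=> k; exact: measurable_gt.
Qed.

Lemma measurable_steps (d' : measure_display) (T' : measurableType d')
    (f : T' -> R) (a : R) (K : nat) :
  measurable_fun setT f -> measurable_fun setT (fun x => steps a K (f x)).
Proof.
move=> mf; apply: measurable_funM => //; apply: measurable_sum => k.
rewrite [X in measurable_fun _ X](_ : _ = \1_[set x | k.+1%:R * a < f x]).
  by apply: measurable_indic; exact: measurable_gt.
apply/funext => x.
by rewrite indicE; congr (nat_of_bool _)%:R; apply/idP/idP; rewrite inE.
Qed.

(** At almost every x, [g0 x > t] forces [g i (x i) > t] for omega-many i, so a strict superlevel
    set of [g0] is no larger than the internal one. This bounds the integral of each step function;
    the mesh then tends to 0 by the ordinary Fatou lemma on the Loeb space. *)
Lemma internal_fatou g (g0 : Om -> R) (c : R) :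
  all_mfun g -> (forall i z, 0 <= g i z) ->
  measurable_fun setT g0 -> (forall x, 0 <= g0 x) -> icvg g g0 ->
  (\forall i \near omega, (\int[P i]_z (g i z)%:E <= c%:E)%E) ->
  (\int[mu]_x (g0 x)%:E <= c%:E)%E.
Proof.
move=> mg g_ge0 mg0 g0_ge0 gg0 gc.
pose f n (x : Om) := (steps n.+1%:R^-1 (n.+1 * n.+1) (g0 x))%:E.
have a0 n : 0 <= n.+1%:R^-1 :> R by rewrite invr_ge0.
have steps0 n y : 0 <= y -> 0 <= steps n.+1%:R^-1 (n.+1 * n.+1) y :> R.
  by move=> y0; rewrite mulr_ge0// sumr_ge0.
have fc n : (\int[mu]_x f n x <= c%:E)%E.
  rewrite /f integral_stepsE// lee_fin.
  set a := n.+1%:R^-1; set K := (n.+1 * n.+1)%N.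
  have aP : 0 <= a by exact: a0.
  pose F k i := [set z : T i | k.+1%:R * a < g i z].
  have mF k : all_meas (F k) by move=> i; exact: measurable_gt.
  apply: (@le_trans _ _ (a * \sum_(k < K) pr mu (internal P (F k)))).
    rewrite ler_wpM2l ?a0// ler_sum// => k _; apply: pr_le_ae.
    - exact: measurable_gt.
    - exact: measurable_internal.
    - apply: filterS gg0 => x gx g0x; exact: cvg_omega_lb gx g0x.
  have cv : (fun i => a * \sum_(k < K) pr (P i) (F k i)) @ omega -->
      a * \sum_(k < K) pr mu (internal P (F k)).
    apply: cvgMr; apply: (@cvg_omega_sum _ (fun k i => pr (P i) (F k i))
      (fun k => pr mu (internal P (F k)))) => k.
    exact: cvg_internal.
  apply: cvg_omega_le cv _ => e e0; apply: filterS gc => i gc.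
  rewrite -lee_fin -integral_stepsE//.
  apply: (@le_trans _ _ c%:E); last by rewrite lee_fin lerDl ltW.
  apply: le_trans gc; apply: ge0_le_integral => //.
  - by move=> z _; rewrite lee_fin steps0.
  - by apply/measurable_EFinP; exact: measurable_steps.
  - by apply/measurable_EFinP.
  - by move=> z _; rewrite lee_fin; exact: (steps_le _ (a0 n) (g_ge0 _ _)).
rewrite [X in (X <= _)%E](_ : _ = \int[mu]_x limn_einf (f^~ x))%E; last first.
  apply: eq_integral => x _.
  have cf : f ^~ x @ \oo --> (g0 x)%:E.
    apply: cvg_EFin; first exact: nearW.
    by rewrite /comp /f /=; exact: steps_cvg.
  by rewrite (cvg_limn_einf_sup cf).1.
have mf n : measurable_fun setT (f n).
  by apply/measurable_EFinP; exact: measurable_steps.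
have f_ge0 n (x : Om) : setT x -> (0 <= f n x)%E.
  by move=> _; rewrite lee_fin steps0.
apply: (le_trans (fatou mu measurableT mf f_ge0)).
exact: limn_einf_le.
Qed.

End limits_of_integrals.

(** * Norms along the ultrafilter *)

Lemma powRVK (R : realType) (x r : R) : 0 <= x -> r != 0 -> (x `^ r^-1) `^ r = x.
Proof. by move=> x0 r0; rewrite -powRrM mulVf// powRr1. Qed.

Lemma powRKV (R : realType) (x r : R) : 0 <= x -> r != 0 -> (x `^ r) `^ r^-1 = x.
Proof. by move=> x0 r0; rewrite -powRrM mulfV// powRr1. Qed.

Lemma cvg_omega_powR (R : realType) (a : nat -> R) (l r : R) :
  0 < r -> (forall i, 0 <= a i) -> a @ omega --> l ->
  (fun i => a i `^ r) @ omega --> l `^ r.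
Proof.
move=> r0 a0 al.
have rN0 : r != 0 by rewrite gt_eqF.
have ltr := gt0_ltr_powR r0.
have ltrV : {in Num.nneg &, {homo (@powR R)^~ r^-1 : x y / x < y}}.
  by apply: gt0_ltr_powR; rewrite invr_gt0.
have l0 : 0 <= l.
  by apply: cvg_omega_ge al _ => e e0; apply: nearW => i; have := a0 i; lra.
apply/cvg_omega_norm => e e0.
have up : \forall i \near omega, a i `^ r < l `^ r + e.
  have y0 : 0 <= l `^ r + e by rewrite addr_ge0// ?powR_ge0// ltW.
  have lty : l < (l `^ r + e) `^ r^-1.
    rewrite -[X in X < _](powRKV l0 rN0); apply: ltrV; rewrite ?nnegrE ?powR_ge0//.
    by rewrite ltrDl.
  apply: filterS (cvg_omega_ub al lty) => i ai.
  by rewrite -[X in _ < X](powRVK y0 rN0); apply: ltr; rewrite ?nnegrE ?powR_ge0.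
have dn : \forall i \near omega, l `^ r - e < a i `^ r.
  have [y0|y0] := ltP (l `^ r - e) 0.
    by apply: nearW => i; apply: lt_le_trans y0 _; exact: powR_ge0.
  have lty : (l `^ r - e) `^ r^-1 < l.
    rewrite -[X in _ < X](powRKV l0 rN0); apply: ltrV; rewrite ?nnegrE ?powR_ge0//.
    by rewrite gtrDl oppr_lt0.
  apply: filterS (cvg_omega_lb al lty) => i ai.
  by rewrite -[X in X < _](powRVK y0 rN0); apply: ltr; rewrite ?nnegrE ?powR_ge0.
by apply: filterS2 up dn => i ? ?; rewrite ler_norml; lra.
Qed.

Lemma integral_cst_probability (R : realType) (d : measure_display)
    (T : measurableType d) (Q : probability T R) (c : R) :
  (\int[Q]_z (cst c%:E z) = c%:E)%E.
Proof.
rewrite integral_cst//; have := @probability_setT _ _ _ Q.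
by move=> /= ->; rewrite mule1.
Qed.

Section Lnorm_real.
Context (R : realType) (d : measure_display) (T : measurableType d).
Context (Q : probability T R).

Lemma Lnorm_leP (f : T -> R) (r c : R) : 0 < r -> 0 <= c ->
  ('N[Q]_(r%:E)[EFin \o f] <= c%:E)%E <->
  (\int[Q]_z (`|f z| `^ r)%:E <= (c `^ r)%:E)%E.
Proof.
move=> r0 c0; have rN0 : r != 0 by rewrite gt_eqF.
have NE : (\int[Q]_z (`|f z| `^ r)%:E = 'N[Q]_(r%:E)[EFin \o f] `^ r)%E.
  by rewrite poweR_Lnorm.
rewrite NE; split=> [Nc|].
  rewrite -poweR_EFin; apply: gt0_ler_poweR => //; first exact: ltW.
  - by rewrite in_itv/= Lnorm_ge0 leey.
  - by rewrite in_itv/= lee_fin c0 leey.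
have /= := @gt0_ler_poweR R r^-1.
rewrite invr_ge0 (ltW r0) => /(_ isT) H /(H _ _ _ _).
rewrite -poweRrM mulfV// poweRe1 ?Lnorm_ge0// poweR_EFin powRKV//; apply.
  by rewrite in_itv/= poweR_ge0 leey.
by rewrite in_itv/= lee_fin powR_ge0 leey.
Qed.

Lemma Lnorm_y_leP (f : T -> R) (c : R) :
  ('N[Q]_(+oo%E)[EFin \o f] <= c%:E)%E <-> \forall z \ae Q, `|f z| <= c.
Proof.
have Q0 : (0 < Q setT)%E by rewrite probability_setT lte01.
rewrite unlock /= Q0; split=> [/ess_supP|fc]; last exact/ess_supP.
by apply: filterS => z.
Qed.

Lemma Lnorm1_le (f : T -> R) (q : \bar R) : measurable_fun setT f ->
  (1 <= q)%E -> ('N[Q]_1[EFin \o f] <= 'N[Q]_q[EFin \o f])%E.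
Proof.
move=> mf; case: q => [q| |//]; last first.
  move=> _; rewrite Lnorm1.
  have := Lnorm_ge0 Q +oo%E (EFin \o f).
  case NE : ('N[Q]_(+oo%E)[EFin \o f])%E => [c| |//] c0; last by rewrite leey.
  have /Lnorm_y_leP fc : ('N[Q]_(+oo%E)[EFin \o f] <= c%:E)%E by rewrite NE.
  apply: (@le_trans _ _ (\int[Q]_z (cst c%:E z))%E); last first.
    by rewrite integral_cst_probability.
  apply: ae_ge0_le_integral => //.
  - by do 2 apply: measurableT_comp => //.
  - by apply: filterS fc => z fz _; rewrite /= lee_fin.
(* For [q = 1] the conjugate exponent would be infinite, so this case is split off before Hölder's
   inequality against the constant 1. *)
rewrite lee_fin le_eqVlt => /predU1P[<-//|q1].
have q0 : 0 < q by apply: lt_trans q1.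
pose r' := (1 - q^-1)^-1.
have r'0 : 0 < r' by rewrite invr_gt0 subr_gt0 invf_lt1.
have qr' : q^-1 + r'^-1 = 1 by rewrite /r' invrK addrC subrK.
have := @hoelder _ _ _ Q f (cst 1) q r' mf (measurable_cst _) q0 r'0 qr'.
rewrite (_ : (f \* cst 1)%R = f); last by apply/funext => z /=; rewrite mulr1.
rewrite (_ : EFin \o cst 1 = cst 1%E)// Lnorm_cst1.
by have /= -> := @probability_setT _ _ _ Q; rewrite poweR1r mule1.
Qed.

End Lnorm_real.

Section limits_of_norms.
Context (R : realType) (d : nat -> measure_display).
Context (T : forall i, measurableType (d i)) (P : forall i, probability (T i) R).
Implicit Types (g h : forall i, T i -> R).

Local Notation Om := (loeb_space P).
Local Notation mu := (loeb_prob P).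

Lemma icvg_norm_powR g (g0 : Om -> R) (r : R) : 0 < r -> icvg g g0 ->
  icvg (fun i z => `|g i z| `^ r) (fun x : Om => `|g0 x| `^ r).
Proof.
move=> r0; apply: filterS => x gx.
by apply: cvg_omega_powR => //; exact: cvg_norm.
Qed.

Lemma measurable_norm_powR (d' : measure_display) (T' : measurableType d')
    (f : T' -> R) (r : R) : measurable_fun setT f ->
  measurable_fun setT (fun x => `|f x| `^ r).
Proof.
move=> mf; apply: (measurableT_comp (measurable_powR r)).
exact: measurableT_comp.
Qed.

Lemma Lnorm_fatou g (g0 : Om -> R) (q : \bar R) (c : R) :
  (1 <= q)%E -> all_mfun g -> measurable_fun setT g0 -> icvg g g0 -> 0 <= c ->
  (\forall i \near omega, ('N[P i]_q[EFin \o g i] <= c%:E)%E) ->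
  ('N[mu]_q[EFin \o g0] <= c%:E)%E.
Proof.
case: q => [r| |//]; last first.
  move=> _ mg mg0 gg0 c0 gc; apply/Lnorm_y_leP.
  have : {ae mu, forall x : Om, \forall i \near omega, `|g i (x i)| <= c}.
    apply: (@ae_internal _ _ _ _ (fun i z => `|g i z| <= c)).
    by apply: filterS gc => i /Lnorm_y_leP.
  apply: filterS2 gg0 => x gx gc'; apply: cvg_omega_le (cvg_norm gx) _ => e e0.
  by apply: filterS gc' => i /le_trans; apply; rewrite lerDl ltW.
rewrite lee_fin => r1 mg mg0 gg0 c0 gc.
have r0 : 0 < r by apply: lt_le_trans r1.
apply/Lnorm_leP => //; apply: (internal_fatou (g := fun i z => `|g i z| `^ r)).
- by move=> i; apply: measurable_norm_powR.
- by move=> i z; exact: powR_ge0.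
- exact: measurable_norm_powR.
- by move=> x; exact: powR_ge0.
- exact: icvg_norm_powR.
- by apply: filterS gc => i /Lnorm_leP; apply.
Qed.

(** Reverse Fatou lemma, from Fatou's lemma for [M - g i]. The uniform bound keeps mass from
    escaping to infinity. *)
Lemma integral_bounded_upper g (g0 : Om -> R) (M c : R) :
  all_mfun g -> (forall i z, 0 <= g i z <= M) ->
  measurable_fun setT g0 -> (forall x, 0 <= g0 x) -> icvg g g0 ->
  (\int[mu]_x (g0 x)%:E < c%:E)%E ->
  \forall i \near omega, (\int[P i]_z (g i z)%:E <= c%:E)%E.
Proof.
move=> mg gM mg0 g00 gg0 g0c; apply: contrapT => /omega_notP nc.
pose I0 := fine (\int[mu]_x (g0 x)%:E).
have I0E : (\int[mu]_x (g0 x)%:E = I0%:E)%E.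
  rewrite /I0 fineK// ge0_fin_numE; first exact: lt_trans g0c (ltry _).
  by apply: integral_ge0 => x _; rewrite lee_fin.
have I0c : I0 < c by rewrite -lte_fin -I0E.
(* The bound [g0 <= M] is inherited only almost everywhere, while [internal_fatou] asks for
   nonnegativity everywhere; hence the truncation at 0. *)
have mh : measurable_fun setT (fun x : Om => Num.max 0 (M - g0 x)).
  by apply: measurable_maxr => //; exact: measurable_funB.
have : (\int[mu]_x (Num.max 0 (M - g0 x))%:E <= (M - c)%:E)%E.
  apply: (internal_fatou (g := fun i z => M - g i z)).
  - by move=> i; apply: measurable_funB => //; exact: mg.
  - by move=> i z; have /andP[_ ?] := gM i z; rewrite subr_ge0.
  - exact: mh.
  - by move=> x; rewrite le_max lexx.
  - apply: filterS gg0 => x gx.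
    have : (fun i => M - g i (x i)) @ omega --> M - g0 x.
      by apply: cvgB => //; exact: cvg_cst.
    rewrite (max_idPr _)// subr_ge0; apply: cvg_omega_le gx _ => e e0.
    by apply: nearW => i; have /andP[_ ?] := gM i (x i); lra.
  - apply: filterS nc => i /negP; rewrite -ltNge => cg.
    have : (\int[P i]_z (M - g i z)%:E + \int[P i]_z (g i z)%:E = M%:E)%E.
      rewrite -ge0_integralD//.
      + under eq_integral => z _ do rewrite -EFinD subrK.
        exact: integral_cst_probability.
      + by move=> z _; have /andP[_ ?] := gM i z; rewrite lee_fin subr_ge0.
      + by apply/measurable_EFinP; apply: measurable_funB => //; exact: mg.
      + by move=> z _; have /andP[? _] := gM i z; rewrite lee_fin.
      + by apply/measurable_EFinP; exact: mg.
    move: cg; have : (0 <= \int[P i]_z (M - g i z)%:E)%E.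
      apply: integral_ge0 => z _; have /andP[_ ?] := gM i z.
      by rewrite lee_fin subr_ge0.
    case: (\int[P i]_z (M - g i z)%:E)%E => [u| |]//;
      case: (\int[P i]_z (g i z)%:E)%E => [v| |]//.
    by rewrite lte_fin !lee_fin -EFinD => ? ? [?]; lra.
have : (M%:E <= \int[mu]_x (Num.max 0 (M - g0 x))%:E + \int[mu]_x (g0 x)%:E)%E.
  rewrite -ge0_integralD//.
  - apply: (@le_trans _ _ (\int[mu]_x (cst M%:E x))%E).
      by rewrite integral_cst_probability.
    apply: ge0_le_integral => //.
    + by move=> x _; have /andP[M1 M2] := gM 0%N (x 0%N); rewrite lee_fin; lra.
    + by apply/measurable_EFinP; exact: measurable_funD.
    + by move=> x _; rewrite lee_fin -lerBlDr le_max lexx orbT.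
  - by move=> x _; rewrite lee_fin le_max lexx.
  - by apply/measurable_EFinP.
  - by move=> x _; rewrite lee_fin.
  - by apply/measurable_EFinP.
rewrite I0E; case: (\int[mu]_x (Num.max 0 (M - g0 x))%:E)%E => [v| |]//.
by rewrite -EFinD !lee_fin; lra.
Qed.

End limits_of_norms.

(** * Binary expansions and lifting of bounded functions *)

Definition dyadic (R : realType) (b : nat -> R) (n : nat) : R :=
  \sum_(k < n) 2^-1 ^+ k.+1 * b k.

Lemma dyadicS (R : realType) (b : nat -> R) (n : nat) :
  dyadic b n.+1 = dyadic b n + 2^-1 ^+ n.+1 * b n.
Proof. by rewrite /dyadic big_ord_recr. Qed.

(** Subtracting 2^-(n + j) makes the bound exact when all digits are 1, which lets the induction on
    j go through. *)
Lemma dyadic_bounds (R : realType) (b : nat -> R) (n j : nat) :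
  (forall k, 0 <= b k <= 1) ->
  dyadic b n <= dyadic b (n + j) <= dyadic b n + 2^-1 ^+ n - 2^-1 ^+ (n + j).
Proof.
move=> b01; elim: j => [|j IH].
  by rewrite addn0 lexx /= addrK.
have e0 : 0 <= (2^-1 : R) ^+ (n + j) by rewrite exprn_ge0// invr_ge0.
have := b01 (n + j)%N; move: IH; rewrite addnS dyadicS !exprS.
move: (2^-1 ^+ (n + j)) e0 (2^-1 ^+ n) (dyadic b _) (dyadic b (n + j)) (b _).
by move=> e e0 e' x y z /andP[xy yx] /andP[z0 z1]; apply/andP; split; nra.
Qed.

Lemma dyadic_range (R : realType) (b : nat -> R) (n : nat) :
  (forall k, 0 <= b k <= 1) -> 0 <= dyadic b n <= 1.
Proof.
move=> b01; have := dyadic_bounds 0 n b01.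
have -> : dyadic b 0 = 0 by rewrite /dyadic big_ord0.
rewrite add0n expr0 add0r => /andP[-> le] /=.
by apply: (le_trans le); rewrite gerDl oppr_le0 exprn_ge0// invr_ge0.
Qed.

Lemma half_expn_lt (R : realType) (e : R) : 0 < e -> exists n : nat, 2^-1 ^+ n <= e.
Proof.
move=> e0; have : 2^-1 ^+ n @[n --> \oo] --> (0 : R).
  by apply: cvg_expr; rewrite ger0_norm; lra.
move=> /cvgrPdist_le/(_ e e0)[n _ /(_ n (leqnn n))] /=.
by rewrite sub0r normrN ger0_norm ?exprn_ge0// => ?; exists n.
Qed.

Section lifting.
Context (R : realType) (d : nat -> measure_display).
Context (T : forall i, measurableType (d i)) (P : forall i, probability (T i) R).
Implicit Types (g h : forall i, T i -> R).

Local Notation Om := (loeb_space P).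
Local Notation mu := (loeb_prob P).

(** The converse direction to [Lnorm_fatou], for a finite exponent: indicators of sets of
    infinitesimal positive measure tend to 0 almost everywhere with sup norm 1. *)
Lemma Lnorm_bounded_upper g (g0 : Om -> R) (M r c : R) :
  0 < r -> all_mfun g -> (forall i z, `|g i z| <= M) ->
  measurable_fun setT g0 -> icvg g g0 ->
  ('N[mu]_(r%:E)[EFin \o g0] < c%:E)%E ->
  \forall i \near omega, ('N[P i]_(r%:E)[EFin \o g i] <= c%:E)%E.
Proof.
move=> r0 mg gM mg0 gg0 Nc.
have c0 : 0 < c by rewrite -lte_fin; apply: le_lt_trans Nc; exact: Lnorm_ge0.
pose n0 := fine ('N[mu]_(r%:E)[EFin \o g0])%E.
have NE : ('N[mu]_(r%:E)[EFin \o g0] = n0%:E)%E.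
  by rewrite /n0 fineK// ge0_fin_numE ?Lnorm_ge0//; exact: lt_trans Nc (ltry _).
have n00 : 0 <= n0 by rewrite -lee_fin -NE Lnorm_ge0.
have n0c : n0 < c by rewrite -lte_fin -NE.
have : (\int[mu]_x (`|g0 x| `^ r)%:E < (c `^ r)%:E)%E.
  apply: (@le_lt_trans _ _ (n0 `^ r)%:E).
    by apply/Lnorm_leP => //; rewrite NE.
  by rewrite lte_fin gt0_ltr_powR// nnegrE ltW.
move=> g0c; have M0 : 0 <= M by apply: le_trans (gM 0%N point).
have := @integral_bounded_upper _ _ _ _ (fun i z => `|g i z| `^ r)
  (fun x => `|g0 x| `^ r) (M `^ r) (c `^ r) => H.

apply: filterS (H _ _ _ _ _ g0c) => [i Hi|i|i z||x|].
- by apply/Lnorm_leP => //; exact: ltW.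
- by apply: measurable_norm_powR.
- by rewrite powR_ge0 ge0_ler_powR ?nnegrE// ltW.
- exact: measurable_norm_powR.
- exact: powR_ge0.
- exact: icvg_norm_powR.
Qed.

(** The greedy binary expansion. The value 1 is expanded as 0.111..., so for u in [0, 1] the
    remainder stays in the closed interval [0, 2^-n]. *)
Fixpoint remainder (u : Om -> R) (n : nat) : Om -> R :=
  if n is m.+1 then fun x =>
    remainder u m x - 2^-1 ^+ m.+1 * \1_[set y | 2^-1 ^+ m.+1 <= remainder u m y] x
  else u.

Definition digit (u : Om -> R) (n : nat) : set Om :=
  [set y | 2^-1 ^+ n.+1 <= remainder u n y].

Lemma measurable_digit (u : Om -> R) (n : nat) : measurable_fun setT u ->
  measurable_fun setT (remainder u n) /\ measurable (digit u n).
Proof.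
have mle (f : Om -> R) t : measurable_fun setT f -> measurable [set x | t <= f x].
  move=> mf; rewrite [X in measurable X](_ : _ = setT `&` f @^-1` `[t, +oo[).
    exact: mf.
  by apply/seteqP; split=> z /=; rewrite in_itv/= andbT// => -[].
move=> um; elim: n => [|n [IH1 IH2]]; first by split=> //; exact: mle.
suff mr : measurable_fun setT (remainder u n.+1) by split=> //; exact: mle.
apply: measurable_funB => //; apply: measurable_funM => //.
Qed.

Lemma remainder_range (u : Om -> R) (n : nat) x : 0 <= u x <= 1 ->
  0 <= remainder u n x <= 2^-1 ^+ n.
Proof.
move=> u01; elim: n => [|n /andP[IH1 IH2]]; first by rewrite expr0.
rewrite /= indicE; have [le|gt] := leP (2^-1 ^+ n.+1) (remainder u n x).
  rewrite mem_set// mulr1 subr_ge0 le /= lerBlDr.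
  have -> : 2^-1 ^+ n.+1 + 2^-1 ^+ n.+1 = 2^-1 ^+ n :> R by rewrite exprS; field.
  exact: IH2.
rewrite memNset/=; first by rewrite mulr0 subr0 IH1 ltW.
by apply/negP; rewrite -ltNge.
Qed.

Lemma remainderE (u : Om -> R) (n : nat) x :
  u x = dyadic (fun k => \1_(digit u k) x) n + remainder u n x.
Proof.
elim: n => [|n IH]; first by rewrite /dyadic big_ord0 add0r.
rewrite dyadicS/= -/(digit u n) -addrA.
by rewrite [X in _ + X]addrC subrK.
Qed.

(* The n-th binary digit of u is the indicator of a Loeb measurable set, which an
   internal set approximates; summing the i first digits of these internal sets
   on the i-th factor lifts u, since the series converges uniformly. *)
Lemma lift_unit (u : Om -> R) : measurable_fun setT u ->
  (forall x, 0 <= u x <= 1) ->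
  exists g, [/\ all_mfun g, forall i z, 0 <= g i z <= 1 & icvg g u].
Proof.
move=> um u01.
have /choice[F FP] n : exists F : forall i, set (T i), all_meas F /\
    {ae mu, forall x : Om, digit u n x <-> internal P F x}.
  have [_ /measurable_loebP[F]] := measurable_digit n um; by exists F.
have ind01 (X : Type) (A : set X) x : 0 <= (\1_A x : R) <= 1.
  by rewrite indicE; case: (_ \in _) => /=; rewrite ?lexx ler01.
exists (fun i z => dyadic (fun k => \1_(F k i) z) i); split.
- move=> i; apply: measurable_sum => k; apply: measurable_funM => //.
  by apply: measurable_indic; exact: (FP k).1.
- by move=> i z; exact: dyadic_range.
have : {ae mu, forall x : Om, forall n, digit u n x <-> internal P (F n) x}.
  have := @ae_foralln _ _ _ mu (fun n (x : Om) => digit u n x <-> internal P (F n) x).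
  by apply => n; exact: (FP n).2.
apply: filterS => x digx; apply/cvg_omega_norm => e e0.
have [n ne] := half_expn_lt e0.
(* Finitely many digits agree for omega-many i at once; beyond them both tails lie in [0, 2^-n], so
   the sums differ by at most e. *)
have : \forall i \near omega, forall k, (k < n)%N ->
    \1_(F k i) (x i) = \1_(digit u k) x :> R.
  elim: n {ne} => [|n IH]; first exact: nearW.
  have : \forall i \near omega, \1_(F n i) (x i) = \1_(digit u n) x :> R.
    have [dx|ndx] := pselect (digit u n x).
      apply: filterS ((digx n).1 dx) => i Fi.
      by rewrite !indicE !mem_set.
    have : internal P (fun i => ~` F n i) x by apply/internal_setC; rewrite -digx.
    by apply: filterS => i Fi; rewrite !indicE !memNset.
  apply: filterS2 IH => i IH Fi k; rewrite ltnS leq_eqVlt => /predU1P[->//|].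
  exact: IH.
apply: filterS2 (omega_ge n) => i ni Fk.
have := dyadic_bounds n (i - n) (fun k => ind01 _ (F k i) (x i)).
rewrite subnKC// => /andP[].
rewrite [dyadic _ n](_ : _ = dyadic (fun k => \1_(digit u k) x) n); last first.
  by apply: eq_bigr => k _; rewrite Fk.
have := remainder_range n (u01 x); rewrite [in `|_ - u x|](remainderE u n x).
have : 0 <= (2^-1 : R) ^+ i by rewrite exprn_ge0// invr_ge0.
move: (remainder u n x) (2^-1 ^+ n) ne (2^-1 ^+ i) (dyadic _ n) (dyadic _ i).
by move=> a b be c y z c0 /andP[? ?] ? ?; rewrite ler_norml; lra.
Qed.

(** An affine change of variable from [-M, M] to [0, 1], with a clipping because the bound on f
    holds only almost everywhere. It divides by M, so M = 0 is treated apart. *)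
Lemma lift_bounded (f : Om -> R) (M : R) : measurable_fun setT f -> 0 <= M ->
  {ae mu, forall x : Om, `|f x| <= M} ->
  exists g, [/\ all_mfun g, forall i z, `|g i z| <= M & icvg g f].
Proof.
move=> mf; rewrite le_eqVlt => /predU1P[<-|M0] fM.
  exists (fun i z => 0); split=> //.
  - by move=> i z; rewrite normr0.
  - apply: filterS fM => x; rewrite normr_le0 => /eqP ->; exact: (@cvg_cst R).
pose u (x : Om) := Num.max 0 (Num.min 1 ((f x / M + 1) / 2)).
have um : measurable_fun setT u.
  apply: measurable_maxr => //; apply: measurable_minr => //.
  by apply: measurable_funM => //; apply: measurable_funD => //; apply: measurable_funM.
have u01 x : 0 <= u x <= 1.
  by rewrite /u le_max lexx /= ge_max ler01 /= ge_min lexx.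
have [g [mg g01 gu]] := lift_unit um u01.
exists (fun i z => M * (2 * g i z - 1)); split.
- move=> i; apply: measurable_funM => //; apply: measurable_funB => //.
  by apply: measurable_funM => //; exact: mg.
- move=> i z; have /andP[g0 g1] := g01 i z.
  by rewrite ler_norml; apply/andP; split; nra.
apply: filterS2 fM gu => x; rewrite ler_norml => /andP[f1 f2] gx.
have -> : f x = M * (2 * u x - 1).
  rewrite /u (min_idPr _); last first.
    have : f x / M <= 1 by rewrite ler_pdivrMr// mul1r.
    by lra.
  rewrite (max_idPr _); last first.
    have : -1 <= f x / M by rewrite ler_pdivlMr// mulN1r.
    by lra.
  by field; rewrite gt_eqF.
apply: cvgM; first exact: cvg_cst.
apply: cvgB; last exact: cvg_cst.
by apply: cvgM => //; exact: cvg_cst.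
Qed.

End lifting.

(** * Norms of multi-P-operators *)

Section multiPop_norm.
Context (R : realType) (d : measure_display) (T : measurableType d).
Context (Q : probability T R).
Implicit Types (f g : T -> R).

Lemma probability_fin_num : Q setT \is a fin_num.
Proof. exact: fin_num_measure. Qed.

Lemma Linfty_pack f (M : R) : measurable_fun setT f -> (forall z, `|f z| <= M) ->
  exists F : Linfty Q, F = f :> (T -> R).
Proof.
move=> mf fM; have fP : f \in Lfun Q +oo%E.
  apply/andP; split; rewrite inE//= /finite_norm.
  apply: le_lt_trans (ltry M); apply/Lnorm_y_leP.
  by apply: aeW => z.
by exists (Lfun_Sub (leey 1%E) fP).
Qed.

Lemma Lone_pack f : measurable_fun setT f ->
  ('N[Q]_1[EFin \o f] < +oo)%E -> exists F : Lone Q, F = f :> (T -> R).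
Proof.
move=> mf fM; have fP : f \in Lfun Q 1%E.
  by apply/andP; split; rewrite inE.
by exists (Lfun_Sub (lexx 1%E) fP).
Qed.

Lemma Linfty_ae_bounded (F : Linfty Q) :
  exists2 M : R, 0 <= M & \forall z \ae Q, `|F z| <= M.
Proof.
have : finite_norm Q +oo%E F by exact: Lfunction_finite.
rewrite /finite_norm.
have := Lnorm_ge0 Q +oo%E (EFin \o F).
case NE : ('N[Q]_(+oo)[EFin \o F])%E => [M| |]// M0 _.
by exists M => //; apply/Lnorm_y_leP; rewrite NE.
Qed.

Definition rnorm (p : \bar R) f : R := fine ('N[Q]_p[EFin \o f])%E.

Lemma rnorm_ge0 p f : 0 <= rnorm p f.
Proof. by rewrite /rnorm fine_ge0// Lnorm_ge0. Qed.

Lemma rnormE (p : \bar R) (F : Linfty Q) : (1 <= p)%E ->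
  ('N[Q]_p[EFin \o F] = (rnorm p F)%:E)%E.
Proof.
move=> p1; rewrite /rnorm fineK// ge0_fin_numE ?Lnorm_ge0//.
have := Lfun_subset p1 (leey 1%E) probability_fin_num (leey p) (LfunP F).
by move=> /andP[_]; rewrite inE.
Qed.

Lemma prod_rnormE n (p : \bar R) (F : 'I_n -> Linfty Q) : (1 <= p)%E ->
  (\big[mule/1]_(i < n) 'N[Q]_p[EFin \o F i] = (\prod_(i < n) rnorm p (F i))%:E)%E.
Proof.
by move=> p1; rewrite -prodEFin; apply: eq_bigr => i _; rewrite rnormE.
Qed.

Lemma rnorm_gt0 (p : \bar R) (F : Linfty Q) : (1 <= p)%E ->
  ~ (F = cst 0 %[ae Q]) -> 0 < rnorm p F.
Proof.
move=> p1 F0; rewrite lt0r rnorm_ge0 andbT; apply/eqP => NF; apply: F0.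
have p0 : (0 < p)%E by apply: lt_le_trans p1; exact: lte01.
have mF : measurable_fun setT (EFin \o F) by exact/measurable_EFinP.
have := @Lnorm_eq0_eq0 _ _ _ Q (EFin \o F) p mF p0.
rewrite rnormE// NF => /(_ erefl); apply: filterS => z /= F0 /F0.
by move=> [].
Qed.

Lemma Lnorm_ae0 (p : \bar R) f : measurable_fun setT f -> (1 <= p)%E ->
  f = cst 0 %[ae Q] -> ('N[Q]_p[EFin \o f] <= 0)%E.
Proof.
move=> mf; case: p => [p| |//] p1 f0; last first.
  by apply/Lnorm_y_leP; apply: filterS f0 => z ->//; rewrite normr0.
have p0 : 0 < p by apply: lt_le_trans ltr01 _; rewrite -lee_fin.
apply/Lnorm_leP => //; rewrite (ae_eq_integral (cst 0%E))//.
- by rewrite integral0 powR0// gt_eqF.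
- by apply/measurable_EFinP; exact: measurable_norm_powR.
- apply: filterS f0 => z f0 _ /=.
  by rewrite f0//= normr0 powR0// gt_eqF.
Qed.

Lemma Lnorm_le_bound (p : \bar R) f (M : R) : measurable_fun setT f -> (1 <= p)%E ->
  0 <= M -> (\forall z \ae Q, `|f z| <= M) -> ('N[Q]_p[EFin \o f] <= M%:E)%E.
Proof.
move=> mf; case: p => [p| |//] p1 M0 fM; last exact/Lnorm_y_leP.
have p0 : 0 < p by apply: lt_le_trans ltr01 _; rewrite -lee_fin.
apply/Lnorm_leP => //; rewrite -[leRHS](integral_cst_probability Q).
apply: ae_ge0_le_integral => //.
- by apply/measurable_EFinP; exact: measurable_norm_powR.
- by move=> z _; rewrite lee_fin powR_ge0.
- by apply: filterS fM => z fz _; rewrite lee_fin ge0_ler_powR ?nnegrE// ltW.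
Qed.

Lemma rnorm_le_rnorm_y (p : \bar R) (F : Linfty Q) : (1 <= p)%E ->
  rnorm p F <= rnorm +oo F.
Proof.
move=> p1; rewrite -lee_fin -rnormE//; apply: Lnorm_le_bound => //.
  exact: rnorm_ge0.
by apply/Lnorm_y_leP; rewrite rnormE// leey.
Qed.

Lemma opnorm_le n (p q : \bar R) (B : ('I_n -> Linfty Q) -> Lone Q) (S : R) :
  (1 <= p)%E ->
  (forall F : 'I_n -> Linfty Q, (forall i, ~ (F i = cst 0 %[ae Q])) ->
    ('N[Q]_q[EFin \o B F] <= (S * \prod_(i < n) rnorm p (F i))%:E)%E) ->
  (opnorm p q B <= S%:E)%E.
Proof.
move=> p1 BS; apply: ge_ereal_sup => _ [F F0 <-].
rewrite prod_rnormE//.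
have pr0 : 0 < \prod_(i < n) rnorm p (F i).
  by apply: prodr_gt0 => i _; exact: rnorm_gt0.
by rewrite inver gt_eqF// lee_pdivrMr// -EFinM; exact: BS.
Qed.

(** The supremum of an empty set would be [-oo], so an admissible argument is exhibited: the
    constant 1. *)
Lemma opnorm_ge0 n (p q : \bar R) (B : ('I_n -> Linfty Q) -> Lone Q) :
  (1 <= p)%E -> (0 <= opnorm p q B)%E.
Proof.
move=> p1.
have [F FE] : exists F : Linfty Q, F = cst 1 :> (T -> R).
  by apply: (@Linfty_pack _ 1) => // z; rewrite /= normr1.
have F0 : ~ (F = cst 0 %[ae Q]).
  move=> F0; have Q0 : (0 < Q setT)%E by have /= -> := @probability_setT _ _ _ Q.
  have PF := ae_properfilter_algebraOfSetsType Q0.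
  by have [z /(_ I)] := filter_ex F0; rewrite FE /= => /eqP; rewrite oner_eq0.
apply: le_trans (ereal_sup_ubound _); last by exists (fun=> F).
rewrite prod_rnormE// inver gt_eqF; last first.
  by apply: prodr_gt0 => i _; exact: rnorm_gt0.
rewrite mule_ge0 ?Lnorm_ge0// lee_fin invr_ge0 prodr_ge0// => i _.
exact: rnorm_ge0.
Qed.

Context (r : nat) (B : multiPop Q r).

(** A function vanishing almost everywhere agrees almost everywhere with [-1 *: F i + F i], to which
    linearity applies. *)
Lemma multiPop_ae0 (F : 'I_r.-1 -> Linfty Q) (i : 'I_r.-1) :
  F i = cst 0 %[ae Q] -> B F = cst 0 %[ae Q].
Proof.
move=> Fi0.
have FE : B F = B (upd F i (-1 *: F i + F i)) %[ae Q].
  apply: multiPop_ae => j; rewrite /upd; case: eqP => [->|_]; last exact: aeW.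
  by apply: filterS Fi0 => z Fz _; rewrite Fz//= scaleN1r addNr.
apply: filterS2 FE (multiPop_linear B F i (-1) (F i) (F i)) => z -> // -> //=.
by rewrite scaleN1r addNr.
Qed.

(** The supremum ranges over arguments with no null component; when some component is null, both
    sides vanish. *)
Lemma opnormP (p q : \bar R) (S : R) (F : 'I_r.-1 -> Linfty Q) :
  (1 <= p)%E -> (1 <= q)%E -> 0 <= S -> (opnorm p q B <= S%:E)%E ->
  ('N[Q]_q[EFin \o B F] <= (S * \prod_(i < r.-1) rnorm p (F i))%:E)%E.
Proof.
move=> p1 q1 S0 BS.
have [[i Fi0]|/forallNP F0] := pselect (exists i, F i = cst 0 %[ae Q]).
  apply: le_trans (Lnorm_ae0 _ q1 (multiPop_ae0 Fi0)) _ => //.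
  by rewrite lee_fin mulr_ge0// prodr_ge0// => j _; exact: rnorm_ge0.
have pr0 : 0 < \prod_(i < r.-1) rnorm p (F i).
  by apply: prodr_gt0 => i _; exact: rnorm_gt0.
rewrite EFinM -lee_pdivrMr//; apply: le_trans BS.
apply: ereal_sup_ubound; exists F => //.
by rewrite prod_rnormE// inver gt_eqF.
Qed.

End multiPop_norm.

(** * The limit operator *)

Lemma cvg_omega_eq (R : realType) (a b : nat -> R) (l : R) :
  (\forall i \near omega, a i = b i) -> a @ omega --> l -> b @ omega --> l.
Proof.
move=> ab /cvg_omega_norm al; apply/cvg_omega_norm => e e0.
by apply: filterS2 ab (al e e0) => i <-.
Qed.

(** Distributes a relative error over n factors. The root of order n + 1 covers n = 0 as well. *)
Lemma root_gt1 (R : realType) (n : nat) (e : R) : 0 < e -> exists2 t : R, 1 < t & t ^+ n <= 1 + e.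
Proof.
move=> e0; have e1 : 1 < 1 + e by rewrite ltrDl.
have e1_ge0 : 0 <= 1 + e by rewrite ltW// (lt_trans ltr01).
have one : 1 `^ n.+1%:R^-1 = 1 :> R by rewrite powR1.
exists ((1 + e) `^ n.+1%:R^-1).
  rewrite -[X in X < _]one gt0_ltr_powR ?invr_gt0 ?nnegrE//.
apply: (@le_trans _ _ (((1 + e) `^ n.+1%:R^-1) ^+ n.+1)).
  rewrite ler_weXn2l// -[X in X <= _]one.
  by rewrite ge0_ler_powR ?nnegrE// ltW.
by rewrite -powR_mulrn ?powR_ge0// -powRrM mulVf ?pnatr_eq0// powRr1.
Qed.

Section limit_operator.
Context (R : realType) (d : nat -> measure_display).
Context (T : forall i, measurableType (d i)) (P : forall i, probability (T i) R).

Local Notation Om := (loeb_space P).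
Local Notation mu := (loeb_prob P).

Implicit Types (a b : forall i, Lone (P i)) (g : forall i, Linfty (P i)).

Lemma icvg_ext (h h' : forall i, T i -> R) (f : Om -> R) :
  {ae mu, forall x : Om, \forall i \near omega, h i (x i) = h' i (x i)} ->
  icvg h f -> icvg h' f.
Proof.
by apply: filterS2 => x; exact: cvg_omega_eq.
Qed.

Lemma exists_lift (f : Linfty mu) (M : R) : 0 <= M ->
  {ae mu, forall x : Om, `|f x| <= M} ->
  exists2 g : forall i, Linfty (P i), (forall i z, `|g i z| <= M) & icvg g f.
Proof.
move=> M0 fM.
have [g [mg gM gf]] := lift_bounded (measurable_funPT f) M0 fM.
have gE i := cid (Linfty_pack (P i) (mg i) (gM i)).
exists (fun i => projT1 (gE i)).
  by move=> i z; rewrite (projT2 (gE i)).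
apply: icvg_ext gf; apply: aeW => x; apply: nearW => i.
by rewrite (projT2 (gE i)).
Qed.

Lemma icvg_unique (h : forall i, T i -> R) (f f' : Om -> R) :
  icvg h f -> icvg h f' -> {ae mu, forall x : Om, f x = f' x}.
Proof. by apply: filterS2 => x; exact: cvg_omega_uniq. Qed.

Lemma Lone_limit a (c : R) :
  (\forall i \near omega, ('N[P i]_1[EFin \o a i] <= c%:E)%E) ->
  exists h : Lone mu, icvg a h.
Proof.
move=> ac.
have [i ci] := filter_ex ac.
have c0 : 0 <= c by rewrite -lee_fin; apply: le_trans ci; exact: Lnorm_ge0.
have ma : all_mfun a by move=> j; exact: measurable_funPT.
have ab : icvg a (istd (P := P) a).
  have : {ae mu, forall x : Om, ibounded a x}.
    apply: (@ae_ibounded _ _ _ _ _ c) => //.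
    by apply: filterS ac => j; rewrite Lnorm1.
  by apply: filterS => x; exact: cvg_istd.
have mi := measurable_istd (P := P) ma.
have Ni := Lnorm_fatou (lexx 1%E) ma mi ab c0 ac.
have [h hE] := Lone_pack mi (le_lt_trans Ni (ltry c)).
by exists h; rewrite hE.
Qed.

(** Pointwise limits exist by [Lone_limit], and Fatou's lemma bounds the norm of the limit by every
    e > 0. No subsequence is extracted, since the limit is taken at points of the product. *)
Lemma Lnorm1_small a :
  (forall e, 0 < e ->
    \forall i \near omega, ('N[P i]_1[EFin \o a i] <= e%:E)%E) ->
  icvg a (cst 0 : Om -> R).
Proof.
move=> a0; have ma : all_mfun a by move=> j; exact: measurable_funPT.
have [h ah] := Lone_limit (a0 1 ltr01).
have mh : measurable_fun setT (EFin \o h) by exact/measurable_EFinP.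
have h0 : ('N[mu]_1[EFin \o h] = 0)%E.
  apply/eqP; rewrite eq_le Lnorm_ge0 andbT; apply/lee_addgt0Pr => e e0.
  rewrite add0e.
  exact: (Lnorm_fatou (lexx 1%E) ma (measurable_funPT h) ah (ltW e0) (a0 e e0)).
have := Lnorm_eq0_eq0 mh lte01 h0.
by apply: filterS2 ah => x ax /(_ I) /= [hx]; rewrite -hx.
Qed.

Context (r : nat) (A : forall i, multiPop (P i) r) (p S : R) (q : \bar R).
Context (p1 : 1 <= p) (q1 : (1 <= q)%E) (S0 : 0 <= S).
Context (AS : forall i, (opnorm p%:E q (A i) <= S%:E)%E).

Implicit Types (G H : 'I_r.-1 -> forall i, Linfty (P i)).

Let p1E : (1 <= p%:E)%E. Proof. by rewrite lee_fin. Qed.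
Let p0 : 0 < p. Proof. exact: lt_le_trans p1. Qed.

Lemma apply_Lnorm1_le (i : nat) (F : 'I_r.-1 -> Linfty (P i)) :
  ('N[P i]_1[EFin \o A i F] <=
   (S * \prod_(j < r.-1) rnorm (P i) p%:E (F j))%:E)%E.
Proof.
apply: le_trans (Lnorm1_le (P i) (measurable_funPT (A i F)) q1) _.
exact: opnormP.
Qed.

Lemma rnorm_le (i : nat) (f : Linfty (P i)) (M : R) : 0 <= M ->
  (forall z, `|f z| <= M) -> rnorm (P i) p%:E f <= M.
Proof.
move=> M0 fM; rewrite -lee_fin -rnormE//; apply: Lnorm_le_bound => //.
exact: aeW.
Qed.

(** This is where p < oo enters: the bounded functions [g i] tending to 0 have infinitesimal L^p
    norm, and the operator bound multiplies it by bounded factors. *)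
Lemma apply_icvg0 G (j : 'I_r.-1) g (M : R) : 0 <= M ->
  (forall k i z, `|G k i z| <= M) -> (forall i z, `|g i z| <= M) ->
  icvg g (cst 0 : Om -> R) ->
  icvg (fun i => A i (upd (G^~ i) j (g i))) (cst 0 : Om -> R).
Proof.
move=> M0 GM gM g0; apply: Lnorm1_small => e e0.
(* K bounds the product of the other norms, so a norm of at most e / (S K + 1) suffices for [g i];
   the added 1 keeps the denominator positive. *)
pose K := M ^+ #|[pred k : 'I_r.-1 | k != j]|.
have K0 : 0 <= K by exact: exprn_ge0.
have SK : 0 < S * K + 1 by rewrite ltr_wpDl// mulr_ge0.
have N0 : ('N[mu]_(p%:E)[EFin \o cst (0%R : R)] < (e / (S * K + 1))%:E)%E.
  rewrite (_ : EFin \o cst (0%R : R) = cst 0%E)//.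
  by rewrite Lnorm0 ?lte_fin ?divr_gt0// gt_eqF// lte_fin.
have mg : all_mfun g by move=> i; exact: measurable_funPT.
have := Lnorm_bounded_upper p0 mg gM (measurable_cst _) g0 N0.
apply: filterS => i Ni; apply: le_trans (apply_Lnorm1_le _) _.
rewrite lee_fin (bigD1 j)//= {1}/upd eqxx.
have ri : rnorm (P i) p%:E (g i) <= e / (S * K + 1).
  by rewrite -lee_fin -rnormE.
have rK : \prod_(k < r.-1 | k != j) rnorm (P i) p%:E (upd (G^~ i) j (g i) k) <= K.
  rewrite /K -prodr_const; apply: ler_prod => k kj.
  rewrite rnorm_ge0 /upd (negbTE kj) /=; exact: rnorm_le.
have : rnorm (P i) p%:E (g i) *
    \prod_(k < r.-1 | k != j) rnorm (P i) p%:E (upd (G^~ i) j (g i) k) <=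
    e / (S * K + 1) * K.
  apply: ler_pM => //; first exact: rnorm_ge0.
  by apply: prodr_ge0 => k _; exact: rnorm_ge0.
move=> /(ler_wpM2l S0) /le_trans; apply.
have -> : S * (e / (S * K + 1) * K) = e * (S * K) / (S * K + 1).
  by field; rewrite gt_eqF.
by rewrite ler_pdivrMr// ler_wpM2l ?ltW// ltrDl.
Qed.

(* The arguments are replaced one at a time; each replacement is multilinear in
   a difference whose L^p norm is infinitesimal, hence so is its image in L^q. *)
Lemma cvg_operator_uniq G H (M : R) : 0 <= M ->
  (forall k i z, `|G k i z| <= M) -> (forall k i z, `|H k i z| <= M) ->
  (forall k, icvg (fun i z => G k i z - H k i z) (cst 0 : Om -> R)) ->
  icvg (fun i z => A i (G^~ i) z - A i (H^~ i) z) (cst 0 : Om -> R).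
Proof.
move=> M0 GM HM GH.
pose hyb (m : nat) (k : 'I_r.-1) := if (k < m)%N then H k else G k.
have hM m k i z : `|hyb m k i z| <= M by rewrite /hyb; case: ifP.
suff : forall m, (m <= r.-1)%N ->
    icvg (fun i z => A i (G^~ i) z - A i ((hyb m)^~ i) z) (cst 0 : Om -> R).
  move=> /(_ _ (leqnn _)); congr icvg; apply: functional_extensionality_dep => i.
  apply/funext => z; congr (_ - A i _ z); apply/funext => k.
  by rewrite /hyb ltn_ord.
elim=> [_|m IH mr].
  apply: aeW => x.
  rewrite [X in X @ omega --> _](_ : _ = cst (0 : R)); first exact: cvg_cst.
  by apply/funext => i; rewrite (_ : (hyb 0)^~ i = G^~ i)// subrr.
pose j := Ordinal mr.
have hybS i : (hyb m.+1)^~ i = upd ((hyb m)^~ i) j (H j i).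
  apply/funext => k; rewrite /hyb /upd ltnS leq_eqVlt -val_eqE /=.
  by case: eqP => //= km; rewrite (_ : k = j)//; exact: val_inj.
have hybm i : (hyb m)^~ i = upd ((hyb m)^~ i) j (G j i).
  apply/funext => k; rewrite /hyb /upd -val_eqE /=.
  by case: eqP => //= km; rewrite km ltnn (_ : k = j)//; exact: val_inj.
(* The difference is written in the shape of [multiPop_linear]. *)
pose dl i : Linfty (P i) := -1 *: H j i + G j i.
have dlE i z : dl i z = G j i z - H j i z.
  by rewrite /dl /= scaleN1r addrC.
have dM i z : `|dl i z| <= M + M.
  by rewrite dlE; apply: le_trans (ler_normB _ _) _; exact: lerD.
have dl0 : icvg dl (cst 0 : Om -> R).
  apply: icvg_ext (GH j); apply: aeW => x; apply: nearW => i; by rewrite dlE.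
have MM : 0 <= M + M by exact: addr_ge0.
have hMM k i z : `|hyb m k i z| <= M + M by apply: le_trans (hM _ _ _ _) _; rewrite lerDl.
have D0 := @apply_icvg0 (hyb m) j dl (M + M) MM hMM dM dl0.
have lin : {ae mu, forall x : Om, \forall i \near omega,
    A i (upd ((hyb m)^~ i) j (dl i)) (x i) =
    A i ((hyb m)^~ i) (x i) - A i ((hyb m.+1)^~ i) (x i)}.
  apply: (@ae_internal _ _ _ _ (fun i z => A i (upd ((hyb m)^~ i) j (dl i)) z =
    A i ((hyb m)^~ i) z - A i ((hyb m.+1)^~ i) z)).
  apply: nearW => i.
  have := multiPop_linear (A i) ((hyb m)^~ i) j (-1) (H j i) (G j i).
  rewrite -hybm -hybS.
  by apply: filterS => z /(_ I) ->; rewrite /= scaleN1r addrC.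
have := IH (ltnW mr).
apply: filterS3 D0 lin => x D0x linx IHx.
have sm : (fun i => A i (G^~ i) (x i) - A i ((hyb m)^~ i) (x i) +
    A i (upd ((hyb m)^~ i) j (dl i)) (x i)) @ omega --> (0 : R).
  by rewrite -(addr0 0); apply: cvgD; [exact: IHx|exact: D0x].
apply: cvg_omega_eq sm.
by apply: filterS linx => i ->; rewrite addrA subrK.
Qed.

Lemma limit_operator_exists : exists A0 : multiPop mu r,
  (opnorm p%:E q A0 <= S%:E)%E /\
  forall (F : 'I_r.-1 -> Linfty mu) G (M : R), 0 <= M ->
    (forall k i z, `|G k i z| <= M) -> (forall k, icvg (G k) (F k)) ->
    icvg (fun i => A i (G^~ i)) (A0 F).
Proof.
have /choice[L LP] (f : Linfty mu) : exists g : forall i, Linfty (P i),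
    (exists2 M : R, 0 <= M & forall i z, `|g i z| <= M) /\ icvg g f.
  have [M M0 fM] := Linfty_ae_bounded f.
  by have [g gM gf] := exists_lift M0 fM; exists g; split=> //; exists M.
have /choice[B BP] (f : Linfty mu) : exists M : R,
    0 <= M /\ forall i z, `|L f i z| <= M.
  by have [[M M0 LM] _] := LP f; exists M.
have /choice[A0 A0P] (F : 'I_r.-1 -> Linfty mu) : exists h : Lone mu,
    icvg (fun i => A i (fun k => L (F k) i)) h.
  apply: (@Lone_limit (fun i => A i (fun k => L (F k) i))
    (S * \prod_(k < r.-1) B (F k))).
  apply: nearW => i; apply: le_trans (apply_Lnorm1_le _) _.
  rewrite lee_fin ler_wpM2l//; apply: ler_prod => k _; rewrite rnorm_ge0 /=.
  by apply: rnorm_le; [exact: (BP _).1|exact: (BP _).2].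
(* [A0] is built from chosen lifts, which need not be linear in f nor respect equality almost
   everywhere. [K] removes the choice: any uniformly bounded lift computes [A0 F], and the algebraic
   properties follow by picking convenient lifts. *)
have K (F : 'I_r.-1 -> Linfty mu) G (M : R) : 0 <= M ->
    (forall k i z, `|G k i z| <= M) -> (forall k, icvg (G k) (F k)) ->
    icvg (fun i => A i (G^~ i)) (A0 F).
  move=> M0 GM GF.
  pose N := M + \sum_(k < r.-1) B (F k).
  have sB0 : 0 <= \sum_(k < r.-1) B (F k) by apply: sumr_ge0 => k _; exact: (BP _).1.
  have N0 : 0 <= N by exact: addr_ge0.
  have GN k i z : `|G k i z| <= N by apply: le_trans (GM k i z) _; rewrite lerDl.
  have LN k i z : `|L (F k) i z| <= N.
    apply: le_trans ((BP (F k)).2 i z) _; rewrite /N (bigD1 k)//= addrCA lerDl.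
    by rewrite addr_ge0// sumr_ge0// => k' _; exact: (BP _).1.
  have GL k : icvg (fun i z => G k i z - L (F k) i z) (cst 0 : Om -> R).
    apply: filterS2 (GF k) (LP (F k)).2 => x Gx Lx.
    by rewrite -[cst 0 x](subrr (F k x)); apply: cvgB; [exact: Gx|exact: Lx].
  apply: filterS2 (A0P F) (@cvg_operator_uniq G (fun k => L (F k)) N N0 GN LN GL).
  move=> x A0x Dx.
  have sm : (fun i => A i (G^~ i) (x i) - A i (fun k => L (F k) i) (x i) +
      A i (fun k => L (F k) i) (x i)) @ omega --> A0 F x.
    by rewrite -[A0 F x]add0r; apply: cvgD; [exact: Dx|exact: A0x].
  by apply: cvg_omega_eq sm; apply: nearW => i; rewrite subrK.
(* The chosen lifts of [F] are also lifts of [F']. *)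
have A0ae (F F' : 'I_r.-1 -> Linfty mu) : (forall k, F k = F' k %[ae mu]) ->
    A0 F = A0 F' %[ae mu].
  move=> FF'; pose M := \sum_(k < r.-1) B (F k).
  have M0 : 0 <= M by apply: sumr_ge0 => k _; exact: (BP _).1.
  have LM k i z : `|L (F k) i z| <= M.
    apply: le_trans ((BP (F k)).2 i z) _; rewrite /M (bigD1 k)//= lerDl.
    by apply: sumr_ge0 => k' _; exact: (BP _).1.
  have LF' k : icvg (L (F k)) (F' k).
    by apply: filterS2 (FF' k) (LP (F k)).2 => x /(_ I) ->.
  have := icvg_unique (A0P F) (K F' (fun k => L (F k)) M M0 LM LF').
  by apply: filterS => x.
have A0lin (F : 'I_r.-1 -> Linfty mu) (k : 'I_r.-1) (a : R) (g h : Linfty mu) :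
    A0 (upd F k (a *: g + h)) =
    a *: A0 (upd F k g) + A0 (upd F k h) %[ae mu].
  pose LF (j : 'I_r.-1) := L (F j).
  (* This lift of [a *: g + h] is the one to which linearity of [A i] applies; the chosen
     [L (a *: g + h)] may be another. The bound M below dominates all lifts in play. *)
  pose Lgh i : Linfty (P i) := a *: L g i + L h i.
  pose M := \sum_(j < r.-1) B (F j) + B g + B h + (`|a| * B g + B h).
  have sB0 : 0 <= \sum_(j < r.-1) B (F j) by apply: sumr_ge0 => j _; exact: (BP _).1.
  have g0 : 0 <= B g by exact: (BP g).1.
  have h0 : 0 <= B h by exact: (BP h).1.
  have ag0 : 0 <= `|a| * B g by exact: mulr_ge0.
  have M0 : 0 <= M by rewrite /M; lra.
  have LFM j i z : `|LF j i z| <= M.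
    apply: (@le_trans _ _ (\sum_(j < r.-1) B (F j))); last by rewrite /M; lra.
    apply: le_trans ((BP (F j)).2 i z) _; rewrite (bigD1 j)//= lerDl.
    by apply: sumr_ge0 => k' _; exact: (BP _).1.
  have gM i z : `|L g i z| <= M.
    by apply: le_trans ((BP g).2 i z) _; rewrite /M; lra.
  have hM i z : `|L h i z| <= M.
    by apply: le_trans ((BP h).2 i z) _; rewrite /M; lra.
  have ghM i z : `|Lgh i z| <= M.
    rewrite /Lgh /=; apply: le_trans (ler_normD _ _) _.
    rewrite normrZ; apply: (@le_trans _ _ (`|a| * B g + B h)); last by rewrite /M; lra.
    by apply: lerD; [apply: ler_wpM2l => //; exact: (BP g).2|exact: (BP h).2].
  have updM (u : forall i, Linfty (P i)) : (forall i z, `|u i z| <= M) ->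
      forall j i z, `|upd LF k u j i z| <= M.
    by move=> uM j i z; rewrite /upd; case: eqP.
  have updL (u : forall i, Linfty (P i)) (f : Linfty mu) : icvg u f ->
      forall j, icvg (upd LF k u j) (upd F k f j).
    by move=> uf j; rewrite /upd; case: eqP => // _; exact: (LP (F j)).2.
  have ghL : icvg Lgh (a *: g + h).
    apply: filterS2 (LP g).2 (LP h).2 => x gx hx.
    by apply: cvgD; [apply: cvgM; [exact: (@cvg_cst R)|exact: gx]|exact: hx].
  have c1 := K _ _ M M0 (updM _ ghM) (updL _ _ ghL).
  have c2 := K _ _ M M0 (updM _ gM) (updL _ _ (LP g).2).
  have c3 := K _ _ M M0 (updM _ hM) (updL _ _ (LP h).2).
  have updE i (u : forall i, Linfty (P i)) : (upd LF k u)^~ i = upd (LF^~ i) k (u i).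
    by apply/funext => j; rewrite /upd; case: eqP.
  have lin : {ae mu, forall x : Om, \forall i \near omega,
      A i ((upd LF k Lgh)^~ i) (x i) =
      a * A i ((upd LF k (L g))^~ i) (x i) + A i ((upd LF k (L h))^~ i) (x i)}.
    apply: (@ae_internal _ _ _ _ (fun i z => A i ((upd LF k Lgh)^~ i) z =
      a * A i ((upd LF k (L g))^~ i) z + A i ((upd LF k (L h))^~ i) z)).
    apply: nearW => i; rewrite !updE.
    have := multiPop_linear (A i) (LF^~ i) k a (L g i) (L h i).
    by apply: filterS => z /(_ I).
  have c23 : {ae mu, forall x : Om, (fun i => a * A i ((upd LF k (L g))^~ i) (x i) +
      A i ((upd LF k (L h))^~ i) (x i)) @ omega -->
      a * A0 (upd F k g) x + A0 (upd F k h) x}.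
    apply: filterS2 c2 c3 => x gx hx.
    by apply: cvgD; [apply: cvgM; [exact: (@cvg_cst R)|exact: gx]|exact: hx].
  apply: filterS3 c1 lin c23 => x c1x linx c23x _.
  by apply: cvg_omega_uniq c23x; apply: cvg_omega_eq linx c1x.
have Nq (F : 'I_r.-1 -> Linfty mu) : (forall i, ~ (F i = cst 0 %[ae mu])) ->
    ('N[mu]_q[EFin \o A0 F] <= (S * \prod_(k < r.-1) rnorm mu p%:E (F k))%:E)%E.
  move=> F0; set D := \prod_(k < _) _.
  have D0 : 0 <= D by apply: prodr_ge0 => k _; exact: rnorm_ge0.
  have SD0 : 0 <= S * D by exact: mulr_ge0.
  apply/lee_addgt0Pr => e e0.
  (* The slack is multiplicative: each norm of a lift exceeds its limit by a factor of at most t,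
     strictly since the limit norms are positive, and t^(r - 1) <= 1 + e / (S D + 1) costs at most e
     on S D. *)
  have e'0 : 0 < e / (S * D + 1) by rewrite divr_gt0// ltr_wpDl.
  have [t t1 tn] := root_gt1 r.-1 e'0.
  have c0 : 0 <= S * (t ^+ r.-1 * D).
    by rewrite mulr_ge0// mulr_ge0// exprn_ge0// ltW// (lt_trans ltr01).
  apply: (@le_trans _ _ (S * (t ^+ r.-1 * D))%:E); last first.
    rewrite -EFinD lee_fin.
    have /(ler_wpM2r SD0) : t ^+ r.-1 <= 1 + e / (S * D + 1) by [].
    rewrite mulrCA => /le_trans; apply; rewrite mulrDl mul1r lerD2l.
    by rewrite mulrAC ler_pdivrMr ?ltr_wpDl// ler_wpM2l ?ltW// ltrDl.
  have mA : all_mfun (fun i => A i (fun k => L (F k) i)).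
    by move=> i; exact: measurable_funPT.
  apply: (Lnorm_fatou q1 mA (measurable_funPT (A0 F)) (A0P F) c0).
  have Lr : \forall i \near omega, forall k : 'I_r.-1,
      rnorm (P i) p%:E (L (F k) i) <= t * rnorm mu p%:E (F k).
    apply: filter_forall => k.
    have mL : all_mfun (L (F k)) by move=> i; exact: measurable_funPT.
    have Nt : ('N[mu]_(p%:E)[EFin \o F k] < (t * rnorm mu p%:E (F k))%:E)%E.
      by rewrite rnormE// lte_fin ltr_pMl// rnorm_gt0.
    have := Lnorm_bounded_upper p0 mL (BP (F k)).2 (measurable_funPT (F k))
      (LP (F k)).2 Nt.
    by apply: filterS => i; rewrite rnormE.
  apply: filterS Lr => i Li; apply: le_trans (opnormP _ p1E q1 S0 (AS i)) _.
  rewrite lee_fin ler_wpM2l//.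
  have -> : t ^+ r.-1 * D = \prod_(k < r.-1) (t * rnorm mu p%:E (F k)).
    by rewrite big_split/= prodr_const card_ord.
  by apply: ler_prod => k _; rewrite rnorm_ge0 /=; exact: Li.
(* On a probability space norms increase with the exponent, so the bound from p to q implies one
   from oo to 1. *)
have A0b : (opnorm +oo 1 A0 < +oo)%E.
  apply: le_lt_trans (ltry S); apply: opnorm_le; first exact: leey.
  move=> F F0; apply: le_trans (Lnorm1_le mu (measurable_funPT (A0 F)) q1) _.
  apply: le_trans (Nq F F0) _; rewrite lee_fin ler_wpM2l//.
  by apply: ler_prod => k _; rewrite rnorm_ge0 /=; exact: rnorm_le_rnorm_y.
exists (MultiPop A0ae A0lin A0b); split; last exact: K.
by apply: opnorm_le.
Qed.

End limit_operator.

(** * The Levy-Prokhorov distance *)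

Section euclidean_distance.
Context (R : realType) (n : nat).
Implicit Types (x y z : n.-tuple R) (U : set (n.-tuple R)).

(* mathcomp-analysis has another [edist], which shadows the Euclidean one. *)
Local Notation edist := Defs.edist.

(** The squares of C a_i - B b_i sum to C (A C - B^2), which is therefore nonnegative; C = 0 forces
    b = 0. *)
Lemma cauchy_schwarz (a b : 'I_n -> R) :
  (\sum_i a i * b i) ^+ 2 <= (\sum_i a i ^+ 2) * (\sum_i b i ^+ 2).
Proof.
set B := \sum_i _ * _; set A := \sum_i a i ^+ 2; set C := \sum_i b i ^+ 2.
have C0 : 0 <= C by apply: sumr_ge0 => i _; exact: sqr_ge0.
have [C0'|C0'] := eqVneq C 0.
  have b0 i : b i = 0.
    move/eqP: C0'; rewrite psumr_eq0 => [/allP/(_ i)|j _]; last exact: sqr_ge0.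
    by rewrite mem_index_enum sqrf_eq0 => /(_ isT)/eqP.
  by rewrite /B big1 ?expr0n ?C0' ?mulr0// => i _; rewrite b0 mulr0.
have Cp : 0 < C by rewrite lt0r C0'.
have : 0 <= \sum_i (C * a i - B * b i) ^+ 2 by apply: sumr_ge0 => i _; exact: sqr_ge0.
have -> : \sum_i (C * a i - B * b i) ^+ 2 = C * (A * C - B ^+ 2).
  rewrite (eq_bigr (fun i => C ^+ 2 * a i ^+ 2 +
    (- (2 * C * B) * (a i * b i) + B ^+ 2 * b i ^+ 2))); last by move=> i _; ring.
  by rewrite !big_split/= -!mulr_sumr -/A -/B -/C; ring.
by rewrite pmulr_rge0// subr_ge0.
Qed.

Lemma edist_ge0 x y : 0 <= edist x y.
Proof. exact: sqrtr_ge0. Qed.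

Lemma edistC x y : edist x y = edist y x.
Proof.
by rewrite /edist; congr Num.sqrt; apply: eq_bigr => i _; rewrite -sqrrN opprB.
Qed.

Lemma edistxx x : edist x x = 0.
Proof.
by rewrite /edist big1 ?sqrtr0// => i _; rewrite subrr expr0n.
Qed.

Lemma edist_triangle y x z : edist x z <= edist x y + edist y z.
Proof.
have s0 (u : 'I_n -> R) : 0 <= \sum_i u i ^+ 2.
  by apply: sumr_ge0 => i _; exact: sqr_ge0.
rewrite -[leRHS]ger0_norm; last by rewrite addr_ge0// edist_ge0.
rewrite -sqrtr_sqr; apply: ler_wsqrtr.
rewrite sqrrD !sqr_sqrtr// -addrA addrCA -mulr_natr.
set a := fun i => tnth x i - tnth y i; set b := fun i => tnth y i - tnth z i.
have -> : \sum_(i < n) (tnth x i - tnth z i) ^+ 2 =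
    2 * \sum_i a i * b i + (\sum_i a i ^+ 2 + \sum_i b i ^+ 2).
  rewrite mulr_sumr -!big_split/=; apply: eq_bigr => i _.
  by rewrite /a /b; ring.
rewrite lerD2r mulrC ler_pM2r//.
apply: le_trans (ler_norm _) _; rewrite -sqrtr_sqr /edist -sqrtrM//.
by apply: ler_wsqrtr; exact: cauchy_schwarz.
Qed.

Lemma edist_le x y (e : R) : 0 <= e -> (forall s, `|tnth x s - tnth y s| <= e) ->
  edist x y <= n%:R * e.
Proof.
move=> e0 xy; have ne0 : 0 <= n%:R * e by rewrite mulr_ge0.
rewrite -[leRHS]ger0_norm// -sqrtr_sqr; apply: ler_wsqrtr.
apply: (@le_trans _ _ (\sum_(i < n) e ^+ 2)).
  apply: ler_sum => i _; rewrite -real_normK ?num_real//.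
  by rewrite ler_sqr ?nnegrE.
rewrite sumr_const card_ord -[leLHS]mulr_natl exprMn ler_wpM2r ?sqr_ge0//.
by rewrite -natrX ler_nat; case: (n) => // m; rewrite leq_pmulr.
Qed.

Lemma thicken_le U (a b : R) : a <= b -> thicken U a `<=` thicken U b.
Proof. by move=> ab x [y Uy xy]; exists y => //; exact: lt_le_trans ab. Qed.

Lemma thicken_thicken U (a b : R) : thicken (thicken U a) b `<=` thicken U (a + b).
Proof.
move=> x [y [z Uz yz] xy]; exists z => //.
by apply: le_lt_trans (edist_triangle y _ _) _; rewrite addrC ltrD.
Qed.

(** Half-open, to match the floor function when a cube is cut into cells. *)
Definition box (c : 'I_n -> R) (a b : R) : set (n.-tuple R) :=
  [set x | forall s, c s + a <= tnth x s < c s + b].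

Lemma measurable_box c a b : measurable (box c a b).
Proof.
rewrite [X in measurable X](_ : _ = \bigcap_(s in [set: 'I_n])
    (setT `&` (fun x : n.-tuple R => tnth x s) @^-1` `[c s + a, c s + b[)).
  apply: fin_bigcap_measurable; first exact: finite_finset.
  by move=> s _; apply: measurable_tnth.
apply/seteqP; split=> [x xB s _|x xB s]; first by split=> //=; rewrite in_itv /= xB.
by have [] := xB s I; rewrite /= in_itv.
Qed.

(** A thickening is open even for arbitrary U, hence the union of the countably many boxes with
    rational centre and side 2 / (k + 1) that it contains. *)
Lemma thicken_measurable U (e : R) : measurable (thicken U e).
Proof.
pose D := ({ffun 'I_n -> rat} * nat)%type.
pose Bx (p : D) := box (fun s => ratr (p.1 s)) (- p.2.+1%:R^-1) p.2.+1%:R^-1.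
rewrite [X in measurable X](_ : _ = \bigcup_m
    (if @unpickle D m is Some p then
       if `[< Bx p `<=` thicken U e >] then Bx p else set0 else set0)).
  apply: bigcupT_measurable => m; case: unpickle => [p|]; last exact: measurable0.
  by case: ifP => // _; exact: measurable_box.
apply/seteqP; split=> [x [y Uy xy]|x [m _]]; last first.
  by case: unpickle => // p; case: asboolP => // pU /pU.
(* Two points of a box of half-side w differ by at most 2 w in each coordinate, so by at most 2 n w;
   this must stay below e - edist x y. *)
have gap : 0 < (e - edist x y) / (2 * n.+1%:R).
  by rewrite divr_gt0 ?subr_gt0// mulr_gt0.
pose k := Num.truncn ((e - edist x y) / (2 * n.+1%:R))^-1.
have kP : k.+1%:R^-1 < (e - edist x y) / (2 * n.+1%:R).
  by rewrite invf_plt ?posrE//; exact: truncnS_gt.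
have k0 : 0 < k.+1%:R^-1 :> R by rewrite invr_gt0.
have /choice[c cP] s : exists c : rat, ratr c \in
    `](tnth x s - k.+1%:R^-1), (tnth x s)[.
  by apply: rat_in_itvoo; rewrite gtrDl oppr_lt0.
pose p : D := ([ffun s => c s], k).
have xp : Bx p x.
  move=> s; rewrite /= ffunE; have := cP s; rewrite in_itv /=.
  move: (ratr _) (k.+1%:R^-1) k0 => u w w0 /andP[c1 c2].
  by apply/andP; split; lra.
exists (pickle p) => //; rewrite pickleK ifT//; apply/asboolP => z zp.
exists y => //.
have zx s : `|tnth z s - tnth x s| <= 2 * k.+1%:R^-1.
  have := zp s; have := xp s; rewrite /= ler_norml.
  move: (ratr _) (k.+1%:R^-1) k0 => u w w0 /andP[x1 x2] /andP[z1 z2].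
  by apply/andP; split; lra.
apply: le_lt_trans (edist_triangle x _ _) _; rewrite -ltrBrDr.
apply: le_lt_trans (edist_le _ zx) _; first by rewrite mulr_ge0// ltW.
have n0 : 0 <= n%:R * 2 :> R by [].
rewrite mulrA; apply: (@le_lt_trans _ _ (2 * n.+1%:R * k.+1%:R^-1)).
  apply: ler_wpM2r; first exact: ltW.
  by rewrite mulrC -!natrM ler_nat leq_mul2l leqnSn.
by rewrite mulrC -ltr_pdivlMr// mulr_gt0.
Qed.

Implicit Types (nu xi rho : probability (n.-tuple R) R).

Definition lp_close nu xi (e : R) := forall U, measurable U ->
  (nu U <= xi (thicken U e) + e%:E)%E /\ (xi U <= nu (thicken U e) + e%:E)%E.

Lemma dLP_le nu xi (e : R) : 0 < e -> lp_close nu xi e -> dLP nu xi <= e.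
Proof.
by move=> e0 H; apply: ge_inf => //; exists 0 => x [/ltW].
Qed.

Lemma lp_close1 nu xi : lp_close nu xi 1.
Proof.
have H (nu' xi' : probability (n.-tuple R) R) U : measurable U ->
    (nu' U <= xi' (thicken U 1) + 1%:E)%E.
  move=> mU; apply: le_trans (probability_le1 nu' mU) _.
  by rewrite leeDr// measure_ge0.
by move=> U mU; split; exact: H.
Qed.

(** Closeness is monotone in e because thickenings are, so every e beyond the infimum is
    admissible. *)
Lemma lp_close_lt nu xi (e : R) : dLP nu xi < e -> lp_close nu xi e.
Proof.
move=> de.
have hi : has_inf [set e : R | 0 < e /\ lp_close nu xi e].
  by split; [exists 1; split=> //; exact: lp_close1|exists 0 => x [/ltW]].
have e0 : 0 < e - dLP nu xi by rewrite subr_gt0.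
have [a [a0 ca] ae] := inf_adherent e0 hi.
have {}ae : a <= e by apply: ltW; move: ae; rewrite -/(dLP nu xi) addrC subrK.
move=> U mU; have [c1 c2] := ca U mU.
have mono (rho : probability (n.-tuple R) R) :
    (rho (thicken U a) + a%:E <= rho (thicken U e) + e%:E)%E.
  apply: leeD; last by rewrite lee_fin.
  apply: le_measure; rewrite ?inE; [exact: thicken_measurable..|].
  exact: thicken_le.
by split; [apply: le_trans c1 _|apply: le_trans c2 _]; exact: mono.
Qed.

Lemma dLP_ge0 nu xi : 0 <= dLP nu xi.
Proof.
apply: lb_le_inf; first by exists 1; split=> //; exact: lp_close1.
by move=> x [/ltW].
Qed.

Lemma dLP_le1 nu xi : dLP nu xi <= 1.
Proof. by apply: dLP_le => //; exact: lp_close1. Qed.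

Lemma dLP_eqr nu xi rho : xi = rho :> (set (n.-tuple R) -> \bar R) ->
  dLP nu xi = dLP nu rho.
Proof. by rewrite /dLP => ->. Qed.

Lemma dLP_triangle xi nu rho (a b : R) : dLP nu xi < a -> dLP xi rho < b ->
  dLP nu rho <= a + b.
Proof.
move=> /[dup] nxa /lp_close_lt nx /[dup] xrb /lp_close_lt xr.
have a0 : 0 < a by exact: le_lt_trans (dLP_ge0 _ _) nxa.
have b0 : 0 < b by exact: le_lt_trans (dLP_ge0 _ _) xrb.
have tri (n1 n2 n3 : probability (n.-tuple R) R) (u v : R) : 0 < u -> 0 < v ->
    lp_close n1 n2 u -> lp_close n2 n3 v ->
    forall U, measurable U -> (n1 U <= n3 (thicken U (u + v)) + (u + v)%:E)%E.
  move=> u0 v0 c12 c23 U mU; apply: le_trans (c12 U mU).1 _.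
  apply: le_trans (leeD2r _ (c23 _ (thicken_measurable U u)).1) _.
  rewrite -addeA -EFinD [v + u]addrC; apply: leeD2r.
  apply: le_measure; rewrite ?inE; [exact: thicken_measurable..|].
  exact: thicken_thicken.
have sym (n1 n2 : probability (n.-tuple R) R) u : lp_close n1 n2 u -> lp_close n2 n1 u.
  by move=> c U mU; have [] := c U mU.
apply: dLP_le; first exact: addr_gt0.
move=> U mU; split; first exact: (tri nu xi rho).
by rewrite [a + b]addrC; apply: (tri rho xi nu) => //; exact: sym.
Qed.

End euclidean_distance.

(** * Laws of almost everywhere limits *)

Section laws_of_limits.
Context (R : realType) (d : nat -> measure_display).
Context (T : forall i, measurableType (d i)) (P : forall i, probability (T i) R).
Context (n : nat).

Local Notation Om := (loeb_space P).
Local Notation mu := (loeb_prob P).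
Local Notation edist := Defs.edist.

Lemma measurable_out_of_cube (d' : measure_display) (T' : measurableType d')
    (X : T' -> n.-tuple R) (M : R) : measurable_fun setT X ->
  measurable [set x | exists s, M <= `|tnth (X x) s|].
Proof.
move=> mX; rewrite [X in measurable X](_ : _ = \bigcup_(s in [set: 'I_n])
    (setT `&` (fun x => `|tnth (X x) s|) @^-1` `[M, +oo[)).
  apply: fin_bigcup_measurable; first exact: finite_finset.
  move=> s _; have : measurable_fun setT (fun x => `|tnth (X x) s|).
    by apply: measurableT_comp => //; exact: (measurableT_comp (measurable_tnth s) mX).
  by apply.
apply/seteqP; split=> [x [s Ms]|x [s _ [_ /=]]].
  by exists s => //; split=> //=; rewrite in_itv/= Ms.
by rewrite in_itv/= andbT; exists s.
Qed.

Lemma tight (X : Om -> n.-tuple R) (e : R) : measurable_fun setT X -> 0 < e ->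
  exists2 M : nat, (0 < M)%N &
    pr mu [set x | exists s, M%:R <= `|tnth (X x) s|] < e.
Proof.
move=> mX e0.
pose F m := ~` [set x : Om | exists s, m%:R <= `|tnth (X x) s|].
have mF m : measurable (F m) by apply: measurableC; exact: measurable_out_of_cube.
have FT : \bigcup_m F m = setT.
  apply/seteqP; split=> // x _.
  exists (Num.truncn (\sum_s `|tnth (X x) s|)).+1 => // -[s].
  apply/negP; rewrite -ltNge; apply: le_lt_trans (truncnS_gt _).
  by rewrite (bigD1 s)//= lerDl sumr_ge0.
have ndF : {homo F : m k / (m <= k)%N >-> (m <= k)%O}.
  move=> m k mk; apply/subsetPset => x Fm [s ks]; apply: Fm; exists s.
  by apply: le_trans ks; rewrite ler_nat.
have := nondecreasing_cvg_mu (mu := mu) mF (bigcupT_measurable _ mF) ndF.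
rewrite FT; have /= -> := @probability_setT _ _ _ mu.
move=> /fine_cvg /cvgrPdist_lt/(_ _ e0)[m _ /(_ m.+1 (leqnSn _))] /= Fm.
exists m.+1 => //.
have := prD mu (mF m.+1) measurableT (@subsetT _ _).
rewrite pr_setT setTD /F setCK => ->.
by apply: le_lt_trans Fm; exact: ler_norm.
Qed.

Lemma filter_forall_fin (I : finType) (Q : I -> nat -> Prop) :
  (forall k, \forall i \near omega, Q k i) ->
  \forall i \near omega, forall k, Q k i.
Proof. by move=> H; apply: filter_forall. Qed.

(* The cube [-M, M[^n is cut into finitely many cells B c of diameter <= e / 8, so
   that only the finitely many unions W J of cells have to be tested, and for them
   the internal probabilities converge: no continuity set is needed. *)
Lemma law_cvg (X : forall i, {mfun T i >-> n.-tuple R})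
    (X0 : {mfun Om >-> n.-tuple R}) :
  {ae mu, forall x : Om, forall s,
     (fun i => tnth (X i (x i)) s) @ omega --> tnth (X0 x) s} ->
  forall e, 0 < e -> \forall i \near omega,
    dLP (distribution (P i) (X i)) (distribution mu X0) <= e.
Proof.
move=> XX0 e e0.
have e40 : 0 < e / 4 by rewrite divr_gt0.
have [M M0 outM] := tight (measurable_funPT X0) e40.
(* The side of the cells, for a diameter of at most e / 8; [n.+1] avoids dividing by 0 when n =
   0. *)
pose dl := e / (8 * n.+1%:R).
have dl0 : 0 < dl by rewrite divr_gt0// mulr_gt0.
have ndl : n%:R * dl <= e / 8.
  have -> : n%:R * dl = e / 8 * (n%:R / n.+1%:R) 
    by rewrite /dl invfM [e * _]mulrA [LHS]mulrC -[LHS]mulrA [in LHS](mulrC _^-1).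
  apply: ler_piMr; first by rewrite ltW// divr_gt0.
  by rewrite ler_pdivrMr// mul1r ler_nat.
pose L := (Num.truncn (2 * M%:R / dl)).+1.
pose I := {ffun 'I_n -> 'I_L}.
pose B (c : I) := box (fun s => dl * (c s)%:R - M%:R) 0 dl.
have B_dist c y z : B c y -> B c z -> edist y z <= e / 8.
  move=> By Bz; apply: le_trans ndl; apply: edist_le (ltW dl0) _ => s.
  have := By s; have := Bz s; rewrite addr0 ler_norml.
  move: (dl * _ - _) => u /andP[? ?] /andP[? ?]; apply/andP; split; lra.
have cover y : (forall s, `|tnth y s| < M%:R) -> exists c, B c y.
  move=> yM; have pos s : 0 <= (tnth y s + M%:R) / dl.
    rewrite divr_ge0 ?ltW//; have := yM s; rewrite ltr_norml => /andP[? _]; lra.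
  have cL s : (Num.truncn ((tnth y s + M%:R) / dl) < L)%N.
    rewrite ltnS; apply: le_truncn; rewrite ler_wpM2r ?invr_ge0 ?ltW//.
    by have := yM s; rewrite ltr_norml => /andP[_ ?]; lra.
  exists [ffun s => Ordinal (cL s)] => s; rewrite ffunE /=.
  have := truncn_itv (pos s); set k := Num.truncn _ => /andP[k1 k2].
  rewrite ler_pdivlMr// in k1; rewrite ltr_pdivrMr// in k2.
  rewrite -natr1 mulrDl mul1r in k2.
  by apply/andP; split; lra.
pose W (J : {set I}) : set (n.-tuple R) := [set y | exists2 c, c \in J & B c y].
have mW J : measurable (W J).
  rewrite [X in measurable X](_ : _ = \bigcup_(c in [set c | c \in J]) B c).
    apply: fin_bigcup_measurable; first exact: finite_finset.
    by move=> c _; exact: measurable_box.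
  by apply/seteqP; split=> [y [c]|y [c]]; exists c.
pose F J i := X i @^-1` W J.
have mF J : all_meas (F J).
  by move=> i; rewrite /F -[X in measurable X]setTI; exact: measurable_funPT.
pose Out i : set (T i) := [set z | exists s, M%:R <= `|tnth (X i z) s|].
have mOut : all_meas Out by move=> i; apply: measurable_out_of_cube.
have mOut0 : measurable [set x : Om | exists s, M%:R <= `|tnth (X0 x) s|].
  exact: measurable_out_of_cube.
have in_cube (x : Om) :
    (forall s, (fun i => tnth (X i (x i)) s) @ omega --> tnth (X0 x) s) ->
    (forall s, `|tnth (X0 x) s| < M%:R) ->
    \forall i \near omega, forall s, `|tnth (X i (x i)) s| < M%:R.
  move=> Xx x0M; apply: filter_forall_fin => s.
  exact: (cvg_omega_ub (cvg_norm (Xx s)) (x0M s)).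
have close (x : Om) :
    (forall s, (fun i => tnth (X i (x i)) s) @ omega --> tnth (X0 x) s) ->
    \forall i \near omega, edist (X i (x i)) (X0 x) <= e / 8.
  move=> Xx; have : \forall i \near omega, forall s,
      `|tnth (X i (x i)) s - tnth (X0 x) s| <= dl.
    by apply: filter_forall_fin => s; exact: (cvg_omega_norm _ _).1.
  by apply: filterS => i Xi; apply: le_trans ndl; apply: edist_le (ltW dl0) _.
(* Tightness of the laws of the [X i] comes from the limit: the condition [M <= |.|] is closed, so
   it passes from omega-many [X i (x i)] to [X0 x]. *)
have outP : \forall i \near omega, pr (P i) (Out i) < e / 4.
  suff lt_out : pr mu (internal P Out) < e / 4.
    exact: (cvg_omega_ub (cvg_internal mOut) lt_out).
  apply: le_lt_trans outM.
  apply: pr_le_ae => //; first exact: measurable_internal.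
  apply: filterS XX0 => x Xx Ox; apply: contrapT => /forallNP x0M.
  have x0M' s : `|tnth (X0 x) s| < M%:R by rewrite ltNge; apply/negP; exact: x0M.
  have [i [[s Ms] /(_ s)]] := omega_ex2 Ox (in_cube x Xx x0M').
  by rewrite ltNge Ms.
have FP : \forall i \near omega, forall J,
    `|pr (P i) (F J i) - pr mu (internal P (F J))| <= e / 4.
  apply: filter_forall_fin => J.
  exact: ((cvg_omega_norm _ _).1 (cvg_internal (mF J))).
apply: filterS2 outP FP => i outi Fi.
apply: dLP_le => // V mV.
have mXV (V' : set (n.-tuple R)) : measurable V' -> measurable (X i @^-1` V').
  by move=> mV'; rewrite -[X in measurable X]setTI; exact: measurable_funPT.
have mX0V (V' : set (n.-tuple R)) : measurable V' -> measurable (X0 @^-1` V').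
  by move=> mV'; rewrite -[X in measurable X]setTI; exact: measurable_funPT.
have mTV := @thicken_measurable _ _ V e.
(* The cells within e / 8 of V, the distance granted by [close]. With the diameter of a cell, [W J]
   stays within e / 4 of V, and one more use of [close] remains below e. The estimates [FP] hold for
   all J at once, hence for every V. *)
pose J : {set I} :=
  [set c | `[< exists v y, [/\ V v, B c y & edist v y <= e / 8] >]]%SET.
have JW y : W J y -> exists2 v, V v & edist y v <= e / 4.
  move=> [c]; rewrite inE => /asboolP[v [y' [Vv By' vy']]] By; exists v => //.
  apply: le_trans (edist_triangle y' _ _) _; rewrite [edist y' v]edistC.
  by have := B_dist _ _ _ By By'; lra.
have WT : W J `<=` thicken V e.
  by move=> y /JW[v Vv yv]; exists v => //; lra.
have := Fi J; rewrite ler_norml => /andP[Fi1 Fi2].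
split; rewrite /distribution /pushforward.
- rewrite !prE//.
  rewrite -EFinD lee_fin.
  have h1 : pr (P i) (X i @^-1` V) <= pr (P i) (F J i) + pr (P i) (Out i).
    apply: le_trans (prU _ (mF J i) (mOut i)).
    apply: pr_le; [exact: mXV|by apply: measurableU; [exact: mF|exact: mOut]|].
    move=> z Vz; have [|nO] := pselect (Out i z); first by right.
    left; have [s|c Bc] := cover (X i z).
      by rewrite ltNge; apply/negP => Ms; apply: nO; exists s.
    exists c => //; rewrite inE; apply/asboolP; exists (X i z), (X i z).
    by rewrite edistxx; split=> //; lra.
  have h2 : pr mu (internal P (F J)) <= pr mu (X0 @^-1` (thicken V e)).
    apply: pr_le_ae; [exact: measurable_internal|exact: mX0V|].
    apply: filterS XX0 => x Xx Fx.
    have [j [Fj cj]] := omega_ex2 Fx (close x Xx).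
    have [v Vv Xv] := JW _ Fj; exists v => //.
    apply: le_lt_trans (edist_triangle (X j (x j)) _ _) _.
    by move: cj; rewrite edistC; lra.
  by lra.
- rewrite !prE//.
  rewrite -EFinD lee_fin.
  have mI := measurable_internal P (mF J).
  have h1 : pr mu (X0 @^-1` V) <= pr mu (internal P (F J)) +
      pr mu [set x : Om | exists s, M%:R <= `|tnth (X0 x) s|].
    apply: le_trans (prU _ mI mOut0).
    apply: pr_le_ae; [exact: mX0V|exact: measurableU|].
    apply: filterS XX0 => x Xx Vx.
    have [|/forallNP x0M] := pselect (exists s, M%:R <= `|tnth (X0 x) s|); first by right.
    have x0M' s : `|tnth (X0 x) s| < M%:R by rewrite ltNge; apply/negP; exact: x0M.
    left; apply: filterS2 (in_cube x Xx x0M') (close x Xx) => j Xj cj.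
    have [c Bc] := cover _ Xj; exists c => //; rewrite inE; apply/asboolP.
    by exists (X0 x), (X j (x j)); rewrite edistC.
  have h2 : pr (P i) (F J i) <= pr (P i) (X i @^-1` (thicken V e)).
    by apply: pr_le; [exact: mF|exact: mXV|move=> z /WT].
  by lra.
Qed.

End laws_of_limits.

(** * Convergence of profiles *)

Section hausdorff.
Context (R : realType) (n : nat).
Implicit Types (X Y : set (probability (n.-tuple R) R)).

Lemma dH_ltP X Y (e : R) : (dH X Y < e%:E)%E ->
  (forall x, X x -> exists2 y, Y y & dLP x y < e) /\
  (forall y, Y y -> exists2 x, X x & dLP x y < e).
Proof.
rewrite /dH gt_max => /andP[XY YX]; split=> [x Xx|y Yy].
- have : (ereal_inf [set (dLP x y)%:E | y in Y] < e%:E)%E.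
    by apply: le_lt_trans XY; apply: ereal_sup_ubound; exists x.
  by move=> /ereal_inf_lt[_ [y Yy <-]]; rewrite lte_fin; exists y.
- have : (ereal_inf [set (dLP x y)%:E | x in X] < e%:E)%E.
    by apply: le_lt_trans YX; apply: ereal_sup_ubound; exists y.
  by move=> /ereal_inf_lt[_ [x Xx <-]]; rewrite lte_fin; exists x.
Qed.

Lemma dH_le X Y (e : R) :
  (forall x, X x -> exists2 y, Y y & dLP x y <= e) ->
  (forall y, Y y -> exists2 x, X x & dLP x y <= e) ->
  (dH X Y <= e%:E)%E.
Proof.
move=> XY YX; rewrite /dH ge_max; apply/andP; split; apply: ge_ereal_sup.
- move=> _ [x /XY[y Yy xy] <-]; apply: (@le_trans _ _ (dLP x y)%:E).
    by apply: ereal_inf_lbound; exists y.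
  by rewrite lee_fin.
- move=> _ [y /YX[x Xx xy] <-]; apply: (@le_trans _ _ (dLP x y)%:E).
    by apply: ereal_inf_lbound; exists x.
  by rewrite lee_fin.
Qed.

Lemma dH_ge0 X Y : X !=set0 -> (0 <= dH X Y)%E.
Proof.
move=> [x Xx]; rewrite /dH le_max; apply/orP; left.
apply: (@le_trans _ _ (ereal_inf [set (dLP x y)%:E | y in Y])).
  by apply: le_ereal_inf_tmp => _ [y _ <-]; rewrite lee_fin dLP_ge0.
by apply: ereal_sup_ubound; exists x.
Qed.

Lemma dH_le1 X Y : X !=set0 -> Y !=set0 -> (dH X Y <= 1)%E.
Proof.
move=> [x Xx] [y Yy]; apply: dH_le => z _; [exists y|exists x] => //;
exact: dLP_le1.
Qed.

End hausdorff.

Lemma cvge0P (R : realType) (u : nat -> \bar R) : (forall i, 0 <= u i)%E ->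
  (forall e : R, 0 < e -> exists N, forall i, (N <= i)%N -> (u i <= e%:E)%E) ->
  u @ \oo --> 0%E.
Proof.
move=> u0 ue; apply/fine_cvgP; split.
  have [N uN] := ue 1 ltr01; exists N => // i /= /uN ui.
  by rewrite ge0_fin_numE// (le_lt_trans ui)// ltry.
apply/cvgrPdist_le => e e0; have [N uN] := ue e e0; exists N => // i /= /uN ui.
have uf : u i \is a fin_num by rewrite ge0_fin_numE// (le_lt_trans ui)// ltry.
rewrite sub0r normrN ger0_norm ?fine_ge0//.
by rewrite -lee_fin fineK.
Qed.

(** The terms up to K carry total weight at most 1 and are bounded by e; the later ones are bounded
    by their weights, of sum 2^-K - 2^-n. The exact partial sums let the induction go through. *)
Lemma geometric_sum_le (R : realType) (u : nat -> \bar R) (K n : nat) (e : R) :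
  0 <= e -> (forall k, 0 <= u k <= 1)%E ->
  (forall k, (1 <= k <= K)%N -> (u k <= e%:E)%E) ->
  (\sum_(1 <= k < n.+1) (2%:R ^- k)%:E * u k <=
   (e * (1 - 2^-1 ^+ n) + (if (n <= K)%N then 0 else 2^-1 ^+ K - 2^-1 ^+ n))%:E)%E.
Proof.
move=> e0 u01 ue; elim: n => [|n IH].
  by rewrite big_geq// expr0 subrr mulr0 add0r.
rewrite big_nat_recr//=; apply: (le_trans (leeD2r _ IH)).
have w0 : 0 <= (2^-1 : R) ^+ n by rewrite exprn_ge0// invr_ge0.
have w1 : 0 <= (2^-1 : R) ^+ n.+1 by rewrite exprn_ge0// invr_ge0.
have wE : (2^-1 : R) ^+ n = 2 * 2^-1 ^+ n.+1 by rewrite exprS mulVKf.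
rewrite -exprVn; have [nK|Kn] := leqP n.+1 K.
  rewrite (ltnW nK).
  apply: (@le_trans _ _ ((e * (1 - 2^-1 ^+ n) + 0)%:E + (2^-1 ^+ n.+1)%:E * e%:E)%E).
    by apply: leeD2l; apply: lee_wpmul2l; [rewrite lee_fin|exact: ue].
  rewrite -EFinM -EFinD lee_fin; move: w0 w1 wE.
  by set w := 2^-1 ^+ n; set w' := 2^-1 ^+ n.+1 => _ _ ->; lra.
apply: (@le_trans _ _ ((e * (1 - 2^-1 ^+ n) +
    (if (n <= K)%N then 0 else 2^-1 ^+ K - 2^-1 ^+ n))%:E + (2^-1 ^+ n.+1)%:E * 1)%E).
  apply: leeD2l; apply: lee_wpmul2l; first by rewrite lee_fin.
  by have /andP[] := u01 n.+1.
rewrite mule1 -EFinD lee_fin.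
have le_e : e * (1 - 2^-1 ^+ n) <= e * (1 - 2^-1 ^+ n.+1).
  by rewrite ler_wpM2l// lerD2l lerN2 wE; lra.
case: leqP => [nK|_]; last by lra.
have -> : K = n by apply/eqP; rewrite eqn_leq nK andbT -ltnS.
by lra.
Qed.

Section dM_lemmas.
Context (R : realType) (r : nat).

(** Keeps the suprema and infima in [dH] from ranging over empty sets. *)
Lemma profile_nonempty (d : measure_display) (T : measurableType d)
    (P : probability T R) (A : multiPop P r) k : profile A k !=set0.
Proof.
have [F FE] : exists F : Linfty P, F = cst 0 :> (T -> R).
  by apply: (@Linfty_pack _ _ _ _ _ 0) => // z; rewrite /= normr0.
eexists; exists (fun _ _ => F) => // i j.
by apply: aeW => x; rewrite FE /= lerN10 ler01.
Qed.

Context (d1 : measure_display) (T1 : measurableType d1) (P1 : probability T1 R).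
Context (d2 : measure_display) (T2 : measurableType d2) (P2 : probability T2 R).
Context (A : multiPop P1 r) (B : multiPop P2 r).

Lemma dM_term_ge0 k : (0 <= (2%:R ^- k : R)%:E * dH (profile A k) (profile B k))%E.
Proof.
rewrite mule_ge0 ?lee_fin ?invr_ge0 ?exprn_ge0//.
by apply: dH_ge0; exact: profile_nonempty.
Qed.

Lemma dM_ge0 : (0 <= dM A B)%E.
Proof. by apply: nneseries_ge0 => k _ _; exact: dM_term_ge0. Qed.

Lemma dH_lt_of_dM k (e : R) : (1 <= k)%N -> (dM A B < (2%:R ^- k * e)%:E)%E ->
  (dH (profile A k) (profile B k) < e%:E)%E.
Proof.
move=> k1 dMe.
have w0 : 0 < 2%:R ^- k :> R by rewrite invr_gt0 exprn_gt0.
rewrite -(@lte_pmul2l _ (2%:R ^- k)%:E)// -EFinM; apply: le_lt_trans dMe.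
apply: (@le_trans _ _ (\sum_(1 <= j < k.+1)
    (2%:R ^- j : R)%:E * dH (profile A j) (profile B j))%E).
  rewrite big_nat_recr//= leeDr// sume_ge0// => j _.
  exact: dM_term_ge0.
by apply: nneseries_lim_ge => j _ _; exact: dM_term_ge0.
Qed.

Lemma dM_le K (e : R) : 0 <= e ->
  (forall k, (1 <= k <= K)%N -> (dH (profile A k) (profile B k) <= e%:E)%E) ->
  (dM A B <= (e + 2^-1 ^+ K)%:E)%E.
Proof.
move=> e0 He; apply: lime_le.
  by apply: is_cvg_nneseries => k _ _; exact: dM_term_ge0.
exists 1%N => // -[//|n] _ /=.
have u01 k : (0 <= dH (profile A k) (profile B k) <= 1)%E.
  by rewrite dH_ge0 ?dH_le1//; exact: profile_nonempty.
apply: le_trans (geometric_sum_le n e0 u01 He) _; rewrite lee_fin lerD//.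
  by rewrite ler_piMr// gerDl oppr_le0 exprn_ge0// invr_ge0.
case: ifP => _; first by rewrite exprn_ge0// invr_ge0.
by rewrite gerDl oppr_le0 exprn_ge0// invr_ge0.
Qed.

End dM_lemmas.

(** * Profiles of the limit operator *)

Section limit_profiles.
Context (R : realType) (d : nat -> measure_display).
Context (T : forall i, measurableType (d i)) (P : forall i, probability (T i) R).
Context (r : nat) (A : forall i, multiPop (P i) r).

Local Notation Om := (loeb_space P).
Local Notation mu := (loeb_prob P).

Context (A0 : multiPop mu r).
Context (A0P : forall (F : 'I_r.-1 -> Linfty mu)
    (G : 'I_r.-1 -> forall i, Linfty (P i)) (M : R), 0 <= M ->
  (forall j i z, `|G j i z| <= M) -> (forall j, icvg (G j) (F j)) ->
  icvg (fun i => A i (G^~ i)) (A0 F)).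

Lemma profile_law_cvg k (G : forall i, 'I_k -> 'I_r.-1 -> Linfty (P i))
    (F : 'I_k -> 'I_r.-1 -> Linfty mu) :
  (forall a j, icvg (fun i => G i a j) (F a j)) ->
  (forall a, icvg (fun i => A i (G i a)) (A0 (F a))) ->
  forall e, 0 < e -> \forall i \near omega,
    dLP (distribution (P i) (profile_vec (A i) (G i)))
        (distribution mu (profile_vec A0 F)) <= e.
Proof.
move=> GF AGF.
apply: (@law_cvg _ _ _ _ _ (fun i => profile_vec (A i) (G i)) (profile_vec A0 F)).
have GF' : {ae mu, forall x : Om, forall a j,
    (fun i => G i a j (x i)) @ omega --> F a j x}.
  apply: (filter_forall (F := almost_everywhere mu)) => a.
  apply: (filter_forall (F := almost_everywhere mu)) => j.
  exact: GF.
have AGF' : {ae mu, forall x : Om, forall a,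
    (fun i => A i (G i a) (x i)) @ omega --> A0 (F a) x}.
  apply: (filter_forall (F := almost_everywhere mu)) => a; exact: AGF.
apply: filterS2 GF' AGF' => x Gx Ax s.
case/mxvec_indexP: s => a j; rewrite tnth_mktuple mxvecE mxE.
have -> : (fun i => tnth (profile_vec (A i) (G i) (x i)) (mxvec_index a j)) =
    (fun i => if insub (val j) is Some l then G i a l (x i) else A i (G i a) (x i)).
  by apply/funext => i; rewrite tnth_mktuple mxvecE mxE.
by case: insub => [l|]; [exact: Gx|exact: Ax].
Qed.

Lemma profile_lift k (F : 'I_k -> 'I_r.-1 -> Linfty mu) :
  (forall a j, {ae mu, forall x, -1 <= F a j x <= 1}) ->
  exists2 G : forall i, 'I_k -> 'I_r.-1 -> Linfty (P i),
    forall i, profile (A i) k (distribution (P i) (profile_vec (A i) (G i))) &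
    forall e, 0 < e -> \forall i \near omega,
      dLP (distribution (P i) (profile_vec (A i) (G i)))
          (distribution mu (profile_vec A0 F)) <= e.
Proof.
move=> F1.
have lft (aj : 'I_k * 'I_r.-1) : exists g : forall i, Linfty (P i),
    (forall i z, `|g i z| <= 1) /\ icvg g (F aj.1 aj.2).
  have [|g g1 gF] := @exists_lift _ _ _ _ (F aj.1 aj.2) 1 ler01.
    by apply: filterS (F1 aj.1 aj.2) => x; rewrite ler_norml.
  by exists g.
have /choice[g gP] := lft.
pose G i a j := g (a, j) i.
exists G.
  move=> i; exists (G i) => // a j; apply: aeW => z.
  by have := (gP (a, j)).1 i z; rewrite ler_norml.
apply: profile_law_cvg => [a j|a]; first exact: (gP (a, j)).2.
apply: (A0P (G := fun j i => G i a j) ler01) => [j i z|j].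
  exact: (gP (a, j)).1.
exact: (gP (a, j)).2.
Qed.

(** The functions of a profile are bounded only almost everywhere, while lifts must be bounded
    everywhere; clipping changes them on null sets, and f is the standard part of the result. *)
Lemma bounded_limit (g : forall i, Linfty (P i)) :
  (forall i, {ae P i, forall z, -1 <= g i z <= 1}) ->
  exists (f : Linfty mu) (h : forall i, Linfty (P i)),
    [/\ {ae mu, forall x, -1 <= f x <= 1}, icvg h f,
        forall i z, `|h i z| <= 1 & forall i, h i = g i %[ae P i]].
Proof.
move=> g1.
have hex i : exists h : Linfty (P i), (forall z, `|h z| <= 1) /\ h = g i %[ae P i].
  pose c z := Num.max (-1) (Num.min 1 (g i z)).
  have mc : measurable_fun setT c.
    by apply: measurable_maxr => //; apply: measurable_minr.
  have c1 z : `|c z| <= 1.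
    rewrite ler_norml /c le_max lexx ge_max ge_min lexx/= andbT.
    by lra.
  have [h hE] := Linfty_pack (P i) mc c1.
  exists h; rewrite hE; split=> //.
  apply: filterS (g1 i) => z /andP[z1 z2] _.
  by rewrite /c (min_idPr z2) (max_idPr z1).
pose h i := projT1 (cid (hex i)); have hP i := projT2 (cid (hex i)).
have mh : all_mfun h by move=> i; exact: measurable_funPT.
have hb x : ibounded (P := P) h x.
  by exists 1; apply: nearW => i; exact: (hP i).1.
have f1 x : `|istd (P := P) h x| <= 1.
  apply: cvg_omega_le (cvg_norm (cvg_istd (hb x))) _ => e e0.
  by apply: nearW => i; apply: le_trans ((hP i).1 _) _; rewrite lerDl ltW.
have [f fE] := Linfty_pack mu (measurable_istd (P := P) mh) f1.
exists f, h; split.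
- by apply: aeW => x; rewrite fE -ler_norml.
- by apply: aeW => x; rewrite fE; exact: cvg_istd.
- by move=> i; exact: (hP i).1.
- by move=> i; exact: (hP i).2.
Qed.

Lemma profile_limit k (G : forall i, 'I_k -> 'I_r.-1 -> Linfty (P i)) :
  (forall i a j, {ae P i, forall z, -1 <= G i a j z <= 1}) ->
  exists2 nu, profile A0 k nu & forall e, 0 < e -> \forall i \near omega,
    dLP (distribution (P i) (profile_vec (A i) (G i))) nu <= e.
Proof.
move=> G1.
have lim (aj : 'I_k * 'I_r.-1) : exists fh : Linfty mu * (forall i, Linfty (P i)),
    [/\ {ae mu, forall x, -1 <= fh.1 x <= 1}, icvg fh.2 fh.1,
        forall i z, `|fh.2 i z| <= 1 & forall i, fh.2 i = G i aj.1 aj.2 %[ae P i]].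
  have [f [h fh]] := @bounded_limit (fun i => G i aj.1 aj.2) (fun i => G1 i _ _).
  by exists (f, h).
have /choice[fh fhP] := lim.
pose F a j := (fh (a, j)).1.
exists (distribution mu (profile_vec A0 F)).
  by exists F => // a j; have [] := fhP (a, j).
apply: profile_law_cvg => [a j|a].
  have [_ hf _ hG] := fhP (a, j).
  apply: icvg_ext hf.
  apply: (@ae_internal _ _ _ _ (fun i z => (fh (a, j)).2 i z = G i a j z)).
  by apply: nearW => i; apply: filterS (hG i) => z; exact.
have AH : icvg (fun i => A i (fun j => (fh (a, j)).2 i)) (A0 (F a)).
  apply: (A0P (G := fun j => (fh (a, j)).2) ler01) => [j i z|j].
    by have [_ _ +] := fhP (a, j).
  by have [_ +] := fhP (a, j).
(* The clipped functions agree with [G] almost everywhere on each factor, and by [multiPop_ae] so do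
   their images. *)
apply: icvg_ext AH.
apply: (@ae_internal _ _ _ _ (fun i z =>
  A i (fun j => (fh (a, j)).2 i) z = A i (G i a) z)).
apply: nearW => i.
have /(multiPop_ae (A i)) : forall j, (fh (a, j)).2 i = G i a j %[ae P i].
  by move=> j; have [_ _ _] := fhP (a, j).
by apply: filterS => z; exact.
Qed.

(** A law in the profile of [A i] is followed through nearby laws in the profiles of the [A j],
    whose limit along [omega] lies in the profile of [A0]. A single j >= N from the ultrafilter then
    gives the estimate for every i >= N. *)
Lemma dH_limit k (e : R) (N : nat) : 0 < e ->
  (forall i j, (N <= i)%N -> (N <= j)%N ->
    (dH (profile (A i) k) (profile (A j) k) < (e / 2)%:E)%E) ->
  forall i, (N <= i)%N -> (dH (profile (A i) k) (profile A0 k) <= e%:E)%E.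
Proof.
move=> e0 cauchy i Ni.
(* Limits give bounds of the form <= e / 4, while [dLP_triangle] asks for the strict bound < e /
   2. *)
have e40 : 0 < e / 4 by lra.
have e42 : e / 4 < e / 2 by lra.
apply: dH_le => [x xA|y [F F1 yE]].
- have ex j : exists G : 'I_k -> 'I_r.-1 -> Linfty (P j),
      (forall a l, {ae P j, forall z, -1 <= G a l z <= 1}) /\
      ((N <= j)%N -> dLP x (distribution (P j) (profile_vec (A j) G)) < e / 2).
    (* For j < N any element of the profile serves as a default. *)
    have [Nj|nNj] := leqP N j; last first.
      by have [_ [G G1 _]] := profile_nonempty (A j) k; exists G.
    have [/(_ x xA)[y [G G1 yE] xy] _] := dH_ltP (cauchy i j Ni Nj).
    by exists G; split=> // _; rewrite (dLP_eqr x yE).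
  pose G j := projT1 (cid (ex j)); have GP j := projT2 (cid (ex j)).
  have [|nu nuA0 Gnu] := @profile_limit k G; first by move=> j; exact: (GP j).1.
  have [j [Gj Nj]] := omega_ex2 (Gnu _ e40) (omega_ge N).
  exists nu => //; rewrite [e]splitr.
  apply: dLP_triangle ((GP j).2 Nj) _; exact: le_lt_trans Gj e42.
- have [G GA GF] := profile_lift F1.
  have [j [Gj Nj]] := omega_ex2 (GF _ e40) (omega_ge N).
  have [_ /(_ _ (GA j))[x xA xG]] := dH_ltP (cauchy i j Ni Nj).
  exists x => //; rewrite -(dLP_eqr x yE) [e]splitr.
  apply: dLP_triangle xG _; exact: le_lt_trans Gj e42.
Qed.

End limit_profiles.

Theorem theorem5p15 (R : realType) (r : nat) (C p : R) (q : \bar R)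
    (d : nat -> measure_display) (T : forall i : nat, measurableType (d i))
    (P : forall i : nat, probability (T i) R)
    (A : forall i : nat, multiPop (P i) r) :
  (2 <= r)%N -> 0 < C -> 1 <= p -> (1 <= q)%E ->
  dM_cauchy A ->
  (forall i : nat, (opnorm p%:E q (A i) <= C%:E)%E) ->
  (exists (d0 : measure_display) (T0 : measurableType d0)
      (P0 : probability T0 R) (A0 : multiPop P0 r),
    [/\ dM (A i) A0 @[i --> \oo] --> 0%E,
        (opnorm p%:E q A0 <=
           ereal_sup [set opnorm p%:E q (A i) | i in [set: nat]])%E &
        (ereal_sup [set opnorm p%:E q (A i) | i in [set: nat]] <= C%:E)%E]) /\
  action_convergent A.
Proof.
move=> _ _ p1 q1 cauchyA AC.
(* The construction is run with the supremum of the norms as its bound, which gives the sharp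
   inequality; C makes this supremum finite. *)
set s := ereal_sup _.
have sC : (s <= C%:E)%E by apply: ge_ereal_sup => _ [i _ <-].
have As i : (opnorm p%:E q (A i) <= s)%E by apply: ereal_sup_ubound; exists i.
have s0 : (0 <= s)%E.
  by apply: le_trans (As 0%N); apply: opnorm_ge0; rewrite lee_fin.
have sE : s = (fine s)%:E.
  by rewrite fineK// ge0_fin_numE// (le_lt_trans sC)// ltry.
have S0 : 0 <= fine s by exact: fine_ge0.
have AS i : (opnorm p%:E q (A i) <= (fine s)%:E)%E by rewrite -sE.
have [A0 [A0S A0P]] := limit_operator_exists p1 q1 S0 AS.
have dHA k : (1 <= k)%N -> forall e : R, 0 < e ->
    exists N, forall i, (N <= i)%N -> (dH (profile (A i) k) (profile A0 k) <= e%:E)%E.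
  move=> k1 e e0.
  (* The factor 2^-k undoes the weight of the k-th term of [dM], leaving the e / 2 that [dH_limit]
     asks for. *)
  have w0 : 0 < 2%:R ^- k * (e / 2) :> R.
    by rewrite mulr_gt0 ?invr_gt0 ?exprn_gt0// divr_gt0.
  have [N AN] := cauchyA _ w0; exists N; apply: (dH_limit A0P e0) => i j Ni Nj.
  by apply: dH_lt_of_dM => //; exact: AN.
have dMA : dM (A i) A0 @[i --> \oo] --> 0%E.
  apply: cvge0P => [i|e e0]; first exact: dM_ge0.
  have e20 : 0 < e / 2 by lra.
  have [K Ke] := half_expn_lt e20.
  (* One N must serve all k <= K; the terms beyond K weigh at most 2^-K <= e / 2 together. *)
  have [N NP] : exists N, forall i, (N <= i)%N -> forall k, (1 <= k <= K)%N ->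
      (dH (profile (A i) k) (profile A0 k) <= (e / 2)%:E)%E.
    elim: {Ke}K => [|K [N NP]]; first by exists 0%N => i _ [|k].
    have [N' N'P] := dHA K.+1 isT _ e20.
    exists (maxn N N') => i; rewrite geq_max => /andP[Ni N'i] k /andP[k1].
    rewrite leq_eqVlt ltnS => /predU1P[->|kK]; first exact: N'P.
    by apply: NP => //; rewrite k1.
  exists N => i Ni; apply: le_trans (dM_le (ltW e20) (NP i Ni)) _.
  by rewrite lee_fin; lra.
split; first by exists _, _, (loeb_prob P), A0; split=> //; rewrite sE.
exists _, _, (loeb_prob P), A0; split=> // k k1.
apply: cvge0P => [i|]; last exact: dHA.
by apply: dH_ge0; exact: profile_nonempty.
Qed.
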